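(* Let $T$ be a minimal aperiodic $r$-interval exchange transformation on $[0,1[$ with discontinuities $\gamma_i$, $1\le i\le r-1$, let $N\ge2$, and let $T_f(x,s)=(Tx,s+f(x))$ on $[0,1[\times\mathbb{Z}/N\mathbb{Z}$ be the Veech 1969 type extension of $T$ by the step function $f$ with marked points $0<\zeta_1<\dots<\zeta_q<1$ and values $a_1,\dots,a_{q+1}\in\mathbb{Z}$. Let - $\gamma'_1<\dots<\gamma'_{\bar q}$ be all the different points among the $\gamma_i$ and the $\zeta_j$, ordered from left to right; - $M$ be the maximal length $m$ of a primitive connection $\gamma'_j=T^m(T\gamma'_i)$, and $M=0$ if there is no such connection; - $R$ be $\bar q$ minus the number of different primitive connections $\gamma'_j=T^m(T\gamma'_i)$; - $\bar L$ be the language of the coding of $T$ by the points $\gamma'_i$, where $[0,\gamma'_1[$ is coded by the symbol $A^{(1)}$, $[\gamma'_i,\gamma'_{i+1}[$ by $A^{(i+1)}$ for $1\le i\le\bar q-1$, and $[\gamma'_{\bar q},1[$ by $A^{(\bar q+1)}$; - $\tilde f$ be the map associating to the symbol $A^{(i)}$ the value ($a_1$, ..., or $a_{q+1}$) of $f$ on the interval coded by $A^{(i)}$. Choose a vertex $w$ of the Rauzy graph $G_{M+1}$ of the language $\bar L$. Then $w$ has exactly $R+1$ different return paths, whose labels are words $U_1,\dots,U_{R+1}$. Let $\xi_{i,j}$ be the number of occurrences of the symbol $A^{(i)}$ in the word $U_j$, $1\le i\le\bar q+1$, $1\le j\le R+1$, and let $$d_j=\sum_{i=1}^{\bar q+1}\xi_{i,j}\,\tilde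 f(A^{(i)}),\qquad 1\le j\le R+1.$$ Then $T_f$ is minimal if and only if $\gcd(N,d_1,\dots,d_{R+1})=1$ (where $0$ is considered to be divisible by every integer).
   Context: Interval exchange: given $\lambda_1,\dots,\lambda_r>0$ with sum $1$ and a permutation $\pi$ of $\{1,\dots,r\}$, put $I_i=[\sum_{j<i}\lambda_j,\sum_{j\le i}\lambda_j[$ (semi-open) and $Tx=x+\sum_{\pi^{-1}(j)<\pi^{-1}(i)}\lambda_j-\sum_{j<i}\lambda_j$ for $x\in I_i$. Its discontinuities are $\gamma_i=\sum_{j\le i}\lambda_j$, $1\le i\le r-1$ (they need not be actual discontinuities). Aperiodic means no periodic point. Minimal: every orbit is dense ($[0,1[\times\{s\}$ has the usual interval topology). Step function: $f$ is the map from $[0,1[$ to $\mathbb{Z}/N\mathbb{Z}$ equal to $a_1$ on $[0,\zeta_1[$, to $a_i$ on $[\zeta_{i-1},\zeta_i[$ for $2\le i\le q$, and to $a_{q+1}$ on $[\zeta_q,1[$ (the integers being reduced modulo $N$). Primitive connection of length $m\ge0$: an equality $\gamma'_j=T^m(T\gamma'_i)$ such that $T^p(T\gamma'_i)\ne\gamma'_k$ for every $k$ and every $0\le p<m$. Language of a coding: for a finite partition of $[0,1[$ into coded intervals, the trajectory of $x$ is the sequence of symbols of the intervals containing $T^nx$, $n\ge0$; the language is the set of all finite factors (blocks of consecutive letters) of all trajectories. Rauzy graph $G_n$ of a language $L$: vertices are the words of length $n$ of $L$, with an edge from $w$ to $w'$ whenever $w=av$, $w'=vb$ for letters $a,b$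 and $avb\in L$. Return path of a vertex $v$ in $G_n$: a path of vertices $v,v_1,\dots,v_z$ (ending by coming back to $v$) with $v_i\ne v$ for $1\le i\le z$, such that the word $vs_1\cdots s_zs$ is in $L$, where $s_1,\dots,s_z,s$ are respectively the last letters of $v_1,\dots,v_z,v$, and the successive length-$n$ suffix windows of $vs_1\cdots s_zs$ are $v,v_1,\dots,v_z,v$. The word $s_1\cdots s_zs$ is the label of the return path. *)

(* Defs.v *)
From HB Require Import structures.
From mathcomp Require Import all_boot all_order all_algebra all_fingroup.
From mathcomp Require Import all_classical all_reals all_analysis.
Set Implicit Arguments.
Unset Strict Implicit.
Unset Printing Implicit Defensive.
Import Order.TTheory GRing.Theory Num.Theory.
Import numFieldNormedType.Exports.
Local Open Scope classical_set_scope.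
Local Open Scope ring_scope.

(* All finite families are indexed from 0: the i-th object of the usual
   numbering 1, ..., n is the value at the ordinal i - 1 of 'I_n. *)

(* Orbits are forward orbits {T^n x, n >= 0}. *)
Definition minimal_on (X : topologicalType) (D : set X) (T : X -> X) : Prop :=
  forall x, D x -> D `<=` closure [set iter n T x | n in [set: nat]].

Definition aperiodic_on (X : Type) (D : set X) (T : X -> X) : Prop :=
  forall x n, D x -> (0 < n)%N -> iter n T x <> x.

Definition unit_itv (R : realType) : set R := `[0, 1[.

Definition iet_left (R : realType) (r : nat) (lam : 'I_r -> R) (i : 'I_r) : R :=
  \sum_(j < r | (j < i)%N) lam j.

Definition iet_right (R : realType) (r : nat) (lam : 'I_r -> R) (i : 'I_r) : R :=
  \sum_(j < r | (j <= i)%N) lam j.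

(* Extended by the identity outside [0, 1[. *)
Definition iet (R : realType) (r : nat) (lam : 'I_r -> R) (pi : 'S_r)
    (x : R) : R :=
  if [pick i : 'I_r | iet_left lam i <= x < iet_right lam i] is Some i then
    x + \sum_(j < r | ((pi^-1)%g j < (pi^-1)%g i)%N) lam j - iet_left lam i
  else x.

(* The marked discontinuities; T may be continuous at some of them. *)
Definition iet_disc (R : realType) (r : nat) (lam : 'I_r -> R) (i : 'I_r.-1) : R :=
  \sum_(j < r | (j <= i)%N) lam j.

(* For increasing points p in ]0, 1[, the intervals [0, p_0[, [p_0, p_1[, ...,
   [p_(k-1), 1[ are numbered 0, ..., k; the number of the one containing x is
   the number of points p_i <= x. *)
Definition cell (R : realType) (k : nat) (p : 'I_k -> R) (x : R) : 'I_k.+1 :=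
  inord #|[pred i | p i <= x]|.

Definition step_fun (R : realType) (q : nat) (zeta : 'I_q -> R)
    (a : 'I_q.+1 -> int) (x : R) : int :=
  a (cell zeta x).

(* The skew product T_f; the fibre carries the discrete topology. To be used
   with 1 < N, since 'Z_N is Z/2Z for N <= 1. *)
Definition skew_product (R : realType) (N : nat) (T : R -> R) (f : R -> 'Z_N)
    (z : R * discrete_topology 'Z_N) : R * discrete_topology 'Z_N :=
  (T z.1, (z.2 : 'Z_N) + f z.1).

(* g_j = T^m (T g_i), with no g_k among T^p (T g_i), 0 <= p < m. *)
Definition primitive_connection (R : realType) (k : nat) (T : R -> R)
    (g : 'I_k -> R) (i j : 'I_k) (m : nat) : Prop :=
  g j = iter m T (T (g i)) /\
  forall p (l : 'I_k), (p < m)%N -> iter p T (T (g i)) <> g l.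

Definition primitive_connections (R : realType) (k : nat) (T : R -> R)
    (g : 'I_k -> R) : set ('I_k * 'I_k * nat) :=
  [set c | primitive_connection T g c.1.1 c.1.2 c.2].

Definition max_connection_length (R : realType) (k : nat) (T : R -> R)
    (g : 'I_k -> R) (M : nat) : Prop :=
  ((exists i j, primitive_connection T g i j M) /\
   (forall i j m, primitive_connection T g i j m -> (m <= M)%N)) \/
  ((forall i j m, ~ primitive_connection T g i j m) /\ M = 0%N).

Definition trajectory (R : realType) (k : nat) (T : R -> R) (g : 'I_k -> R)
    (x : R) (n : nat) : 'I_k.+1 :=
  cell g (iter n T x).

Definition coding_language (R : realType) (k : nat) (T : R -> R)
    (g : 'I_k -> R) : set (seq 'I_k.+1) :=
  [set u | exists x m, unit_itv x /\
     u = mkseq (fun l => trajectory T g x (m + l)) (size u)].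

Definition rauzy_vertex (A : eqType) (L : set (seq A)) (n : nat)
    (w : seq A) : Prop :=
  L w /\ size w = n.

Definition rauzy_edge (A : eqType) (L : set (seq A)) (n : nat)
    (w w' : seq A) : Prop :=
  [/\ rauzy_vertex L n w, rauzy_vertex L n w' &
      exists a v b, [/\ w = a :: v, w' = rcons v b & L (a :: rcons v b)]].

(* A return path v, v_1, ..., v_z, v of the vertex v is represented by the
   sequence vs = [:: v_1; ...; v_z]; only used for vertices of positive length,
   so that the default value of last is irrelevant. *)
Definition return_label (k : nat) (v : seq 'I_k.+1)
    (vs : seq (seq 'I_k.+1)) : seq 'I_k.+1 :=
  [seq last ord0 u | u <- rcons vs v].

Definition return_path (k : nat) (L : set (seq 'I_k.+1)) (n : nat)
    (v : seq 'I_k.+1) (vs : seq (seq 'I_k.+1)) : Prop :=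
  let W := v ++ return_label v vs in
  [/\ path (fun u u' => `[< rauzy_edge L n u u' >]) v (rcons vs v),
      v \notin vs,
      L W &
      forall l, (l <= (size vs).+1)%N ->
        take n (drop l W) = nth v (v :: rcons vs v) l].

(* Main.v *)
Require Import Defs.
From mathcomp Require Import all_boot all_order all_algebra all_fingroup.
From mathcomp Require Import all_classical all_reals all_analysis.
From mathcomp Require Import lra zify.
Set Implicit Arguments.
Unset Strict Implicit.
Unset Printing Implicit Defensive.
Import Order.TTheory GRing.Theory Num.Theory.
Import numFieldNormedType.Exports.
Local Open Scope classical_set_scope.
Local Open Scope ring_scope.

(** Write G for the set of the marked points [gamma' i], f for the step
function and J for the cylinder of w, that is, the set of the points whose
itinerary begins with w. It is an interval with a least point alpha, and none
of its other points meets G before time M.+1.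

The number of return paths. A return path is the itinerary of a point of J
read until its first return to J, so the return paths correspond to the maximal
subintervals of J on which this itinerary is constant. Such a subinterval
begins at alpha or at a cut point: a point x > alpha of J whose orbit meets G
before the return word is complete, for the first time at
[iter l T x = gamma' j], say. Then l > M. If [gamma' j] were the end of a
connection, it would be the end of a primitive one, of length at most M, and
the orbit of x would have met G earlier. So [gamma' j] is the end of no
connection, and x is recovered from j as the first visit to J on the backward
orbit that starts M.+1 steps before [gamma' j]. Conversely every such j gives a
cut point, provided that backward orbits enter J ([backward_entry]). A point of
G that ends a connection ends exactly one primitive connection, hence Rr points
of G end none, and there are Rr.+1 return paths ([card_return_paths]).

Necessity of the gcd condition. The words w ++ U and V ++ w, where V is the
itinerary of x up to its first return to J and U is the label of the return
path, are equal. So U and V have the same letters, and d j is the sum of f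
between x and its first return. The orbit of (x, 0), for x in J, therefore
visits J only over the multiples of the gcd.

Sufficiency. Fix an orbit of the skew product and let K(x) be the set of the
fibre values that it accumulates at x from the right. Then K(T x) is the
translate of K(x) by f x; by minimality of T all the sets K(x) have the same
cardinal, and semicontinuity turns this into local constancy of K on the right
of each point. A jump of K on the left of a point y propagates to T y unless y
is in G, and to the preimage of y unless that preimage is in G or is 0, which
is itself the image of a point of G. Forward and backward orbits of T enter an
interval on which K is constant, so both propagations have to be stopped: y
lies on a primitive connection, and meets G within M steps. Since no point of J other than alpha does, K is constant on J
([right_limits_cylinder]). Going once around a return path then shows that K is
invariant under every d j; if the gcd is 1 then K is the whole fibre on J, and
everywhere because the cardinal of K is constant. This is the density of the
orbit ([fibre_dense]). *)

(** * Local arguments on intervals and finite sets *)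

(** Real induction: a property of intervals that is additive and holds for the
short intervals on both sides of each point holds for [a, b], by considering
the supremum of the z such that it holds for [a, z]. It turns local constancy
into constancy and local boundedness into boundedness. *)
Lemma interval_induction (R : realType) (P : R -> R -> Prop) (a b : R) :
  a < b ->
  (forall x y z, a <= x -> x < y -> y < z -> z <= b -> P x y -> P y z -> P x z) ->
  (forall x, a <= x < b ->
     exists2 e, 0 < e & forall y, x < y < x + e -> y <= b -> P x y) ->
  (forall x, a < x <= b ->
     exists2 e, 0 < e & forall y, x - e < y < x -> a <= y -> P y x) ->
  P a b.
Proof.
move=> ab Padd Pright Pleft.
pose A : set R := [set z | a < z <= b /\ P a z].
have [e e0 ae] : exists2 e, 0 < e & forall y, a < y < a + e -> y <= b -> P a y.
  by apply: Pright; rewrite lexx.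
have A0 : A !=set0.
  pose y := Num.min b (a + e / 2).
  have yb : y <= b by rewrite ge_min lexx.
  have ya : a < y by rewrite lt_min ab /= ltrDl divr_gt0.
  exists y; split; rewrite ?ya ?yb //; apply: ae => //; rewrite ya /=.
  by rewrite gt_min; apply/orP; right; lra.
have Ab : ubound A b by move=> z [/andP[]].
have hA : has_sup A by split=> //; exists b.
pose s := sup A.
have sb : s <= b by apply: ge_sup.
have as_ : a < s.
  have [z zA] := A0; have [/andP[az _] _] := zA.
  by apply: lt_le_trans az _; apply: ub_le_sup => //; exists b.
have Pas : P a s.
  have [|d d0 Pd] := Pleft s; first by rewrite as_ sb.
  have [z zA sz] := sup_adherent d0 hA; have [/andP[az zb] Paz] := zA.
  have zs : z <= s by apply: ub_le_sup => //; exists b.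
  have [<-//|zns] := eqVneq z s.
  have {}zs : z < s by rewrite lt_neqAle zns.
  apply: (Padd a z s) => //; apply: Pd; last exact: ltW.
  by rewrite zs andbT.
have [<-//|snb] := eqVneq s b.
have {}sb : s < b by rewrite lt_neqAle snb.
have [|d d0 Pd] := Pright s; first by rewrite sb (ltW as_).
pose y := Num.min b (s + d / 2).
have yb : y <= b by rewrite ge_min lexx.
have ys : s < y by rewrite lt_min sb /= ltrDl divr_gt0.
have yd : y < s + d by rewrite gt_min; apply/orP; right; lra.
suff : y <= s by rewrite leNgt ys.
apply: ub_le_sup; first by exists b.
split; first by rewrite yb (lt_trans as_).
apply: (Padd a s y) => //; apply: Pd => //; by rewrite ys.
Qed.

(** Thresholds that exist for each index of a finite family can be made common
by taking the smallest e and the largest m. *)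
Lemma uniform_threshold (R : realType) (F : finType) (P : F -> R -> nat -> Prop) :
  (forall i, exists2 e, 0 < e & exists m0, forall e' m, 0 < e' <= e -> (m0 <= m)%N ->
     P i e' m) ->
  exists2 e, 0 < e & exists m, forall i, P i e m.
Proof.
move=> HP.
suff [e e0 [m Hm]] : exists2 e, 0 < e & exists m0, forall i, i \in enum F ->
    forall e' m, 0 < e' <= e -> (m0 <= m)%N -> P i e' m.
  exists e => //; exists m => i; apply: Hm; rewrite ?mem_enum ?lexx ?e0 //.
elim: (enum F) => [|i s [e e0 [m Hm]]]; first by exists 1 => //; exists 0%N.
have [e1 e10 [m1 Hm1]] := HP i.
exists (Num.min e e1); first by rewrite lt_min e0.
exists (maxn m m1) => j; rewrite inE => + e' m' /andP[e'0].
rewrite le_min geq_max => + /andP[ee ee1] /andP[mm mm1].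
by case/orP => [/eqP->|js]; [apply: Hm1 | apply: Hm]; rewrite ?e'0.
Qed.

Lemma card_eq_finset (I : finType) (A : {set I}) :
  ([set` A] #= `I_#|A|)%card.
Proof.
rewrite (card_eqr card_II).
suff -> : [set` A] = (fun i : 'I_#|A| => enum_val i) @` setT.
  by apply: inj_card_eq => i j _ _; apply: enum_val_inj.
apply/seteqP; split=> [x /= xA|_ [i _ <-]]; last exact: enum_valP.
by exists (enum_rank_in xA x) => //; rewrite enum_rankK_in.
Qed.

(** * Cells of a finite set of marked points *)

Section Cells.
Variables (R : realType) (k : nat) (g : 'I_k -> R).

Lemma cell_val x : cell g x = #|[pred i | g i <= x]| :> nat.
Proof. by rewrite /cell inordK // ltnS -[X in (_ <= X)%N]card_ord max_card. Qed.

Lemma cell_eq x y : x <= y ->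
  (cell g x = cell g y) <-> (forall i, ~ (x < g i <= y)).
Proof.
move=> xy.
have sub : [pred i | g i <= x] \subset [pred i | g i <= y].
  by apply/fintype.subsetP => i; rewrite !inE => /le_trans; apply.
split=> [/(congr1 val) /=|H].
  rewrite !cell_val => E i /andP[xi iy].
  have := (subset_leqif_card sub).2; rewrite E eqxx => sub'.
  have /fintype.subsetP/(_ i) : [pred i | g i <= y] \subset [pred i | g i <= x].
    by rewrite -sub'.
  by rewrite !inE => /(_ iy); rewrite leNgt xi.
apply: val_inj => /=; rewrite !cell_val; apply: eq_card => i; rewrite !inE.
apply/idP/idP => [/le_trans/(_ xy)//|iy].
by rewrite leNgt; apply/negP => xi; apply: (H i); rewrite xi.
Qed.

Lemma cell_right x : exists2 e, 0 < e &
  forall y, x <= y < x + e -> cell g y = cell g x.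
Proof.
have [|e e0 [_ He]] := @uniform_threshold R 'I_k
    (fun i e _ => ~ (x < g i < x + e)).
  move=> i; case: (ltP x (g i)) => xi.
    exists (g i - x); rewrite ?subr_gt0 //; exists 0%N => e' _ /andP[_ e'g] _.
    by move=> ?; lra.
  by exists 1 => //; exists 0%N => e' _ _ _ ?; lra.
exists e => // y /andP[xy ye]; apply/esym/cell_eq => // i /andP[xi iy].
by apply: (He i); rewrite xi (le_lt_trans iy).
Qed.

(** The cell has a limit on the left of every point: this includes the marked
points, where it jumps, and 1, the right end of the domain. *)
Lemma cell_left x : exists2 e, 0 < e &
  forall y z, x - e < y < x -> x - e < z < x -> cell g y = cell g z.
Proof.
have [|e e0 [_ He]] := @uniform_threshold R 'I_k
    (fun i e _ => ~ (x - e < g i < x)).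
  move=> i; case: (ltP (g i) x) => xi.
    exists (x - g i); rewrite ?subr_gt0 //; exists 0%N => e' _ /andP[_ e'g] _.
    by move=> ?; lra.
  by exists 1 => //; exists 0%N => e' _ _ _ ?; lra.
exists e => //.
have H y z : y <= z -> x - e < y < x -> x - e < z < x -> cell g y = cell g z.
  move=> yz /andP[y1 y2] /andP[z1 z2]; apply/cell_eq => // i /andP[xi iy].
  by apply: (He i); rewrite (lt_trans y1) //= (le_lt_trans iy).
by move=> y z Hy Hz; case: (leP y z) => [|/ltW] yz; [|apply/esym]; apply: H.
Qed.

(** The cell changes from the left only at the marked points, because the
intervals of the coding are closed on the left. *)
Lemma cell_left_point x : (forall i, x <> g i) -> exists2 e, 0 < e &
  forall y, x - e < y <= x -> cell g y = cell g x.
Proof.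
move=> xg.
have [|e e0 [_ He]] := @uniform_threshold R 'I_k
    (fun i e _ => ~ (x - e < g i <= x)).
  move=> i; case: (ltP (g i) x) => xi.
    exists (x - g i); rewrite ?subr_gt0 //; exists 0%N => e' _ /andP[_ e'g] _.
    by move=> ?; lra.
  exists 1 => //; exists 0%N => e' _ _ _ /andP[_ ix].
  by apply: (xg i); apply/le_anti; rewrite xi ix.
exists e => // y /andP[y1 y2]; apply/cell_eq => // i /andP[xi iy].
by apply: (He i); rewrite (lt_trans y1) //= (le_lt_trans iy).
Qed.

End Cells.

(** * Itineraries under a minimal exchange *)

(** The properties of an interval exchange on which the argument rests: its
lengths and its permutation enter only through the fact that it translates
each cell of the marked points ([exch_cell]). Since the marked points may be
more numerous than the discontinuities, the cells are those of the coding. *)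
Record minimal_exchange (R : realType) (k : nat) (T : R -> R) (g : 'I_k -> R)
    : Prop := MinimalExchange {
  exch_itv : forall x : R, 0 <= x < 1 -> 0 <= T x < 1;
  exch_inj : forall x y : R, 0 <= x < 1 -> 0 <= y < 1 -> T x = T y -> x = y;
  exch_surj : forall y : R, 0 <= y < 1 -> exists2 x, 0 <= x < 1 & T x = y;
  exch_cell : forall x y : R, 0 <= x < 1 -> 0 <= y < 1 ->
    cell g x = cell g y -> T x - x = T y - y;
  exch_dense : forall x a b : R, 0 <= x < 1 -> 0 <= a -> a < b -> b <= 1 ->
    exists n, a < iter n T x < b;
  exch_aper : forall (x : R) n, 0 <= x < 1 -> iter n.+1 T x <> x;
  exch_marks : forall i, 0 < g i < 1;
  exch_marks_inj : injective g
}.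

Section Exchange.
Variables (R : realType) (k : nat) (T : R -> R) (g : 'I_k -> R).
Hypothesis TP : minimal_exchange T g.

Definition itinerary (x : R) (m : nat) : seq 'I_k.+1 :=
  mkseq (trajectory T g x) m.

Lemma size_itinerary x m : size (itinerary x m) = m.
Proof. exact: size_mkseq. Qed.

Lemma itineraryS x m : itinerary x m.+1 = cell g x :: itinerary (T x) m.
Proof.
rewrite /itinerary /mkseq /= -[1%N]/(1 + 0)%N iotaDl -map_comp; congr (_ :: _).
by apply: eq_map => i /=; rewrite /trajectory -iterSr.
Qed.

Lemma itinerary_nth x y m : itinerary x m = itinerary y m <->
  forall i, (i < m)%N -> cell g (iter i T x) = cell g (iter i T y).
Proof.
split=> [E i im|H].
  have := congr1 (fun s => nth ord0 s i) E.
  by rewrite /itinerary !nth_mkseq.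
apply: (@eq_from_nth _ ord0); rewrite !size_itinerary // => i im.
by rewrite /itinerary !nth_mkseq // /trajectory H.
Qed.

Lemma iter_itv n (x : R) : 0 <= x < 1 -> 0 <= iter n T x < 1.
Proof. by move=> Hx; elim: n => //= n; apply: (exch_itv TP). Qed.

Lemma iter_inj n (x y : R) : 0 <= x < 1 -> 0 <= y < 1 -> iter n T x = iter n T y -> x = y.
Proof.
move=> Hx Hy; elim: n => //= n IH E; apply: IH.
by apply: (exch_inj TP) E; apply: iter_itv.
Qed.

Lemma iter_surj n (y : R) : 0 <= y < 1 -> exists2 x, 0 <= x < 1 & iter n T x = y.
Proof.
elim: n y => [|n IH] y Hy; first by exists y.
have [x Hx <-] := exch_surj TP Hy; have [z Hz <-] := IH x Hx.
by exists z.
Qed.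

(** As long as two points have the same itinerary, they move together. *)
Lemma itinerary_shift m (x y : R) : 0 <= x < 1 -> 0 <= y < 1 ->
  itinerary x m = itinerary y m ->
  forall i, (i <= m)%N -> iter i T x - x = iter i T y - y.
Proof.
move=> Hx Hy /itinerary_nth E; elim=> [|i IH] im /=; first lra.
have := exch_cell TP (iter_itv i Hx) (iter_itv i Hy) (E i im).
have := IH (ltnW im); lra.
Qed.

Lemma itinerary_right m (x : R) : 0 <= x < 1 -> exists2 e, 0 < e &
  forall y, x <= y < x + e -> y < 1 /\ itinerary y m = itinerary x m.
Proof.
elim: m x => [|m IH] x Hx; first by exists (1 - x); [lra|move=> y ?; split=> //; lra].
have [e e0 He] := cell_right g x.
have [d d0 Hd] := IH _ (exch_itv TP Hx).
exists (Num.min (Num.min e d) (1 - x)); first by rewrite !lt_min e0 d0; lra.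
move=> y /andP[xy]; rewrite -ltrBlDl !lt_min => /andP[/andP[ye yd] y1].
have {}y1 : y < 1 by lra.
have Hy : 0 <= y < 1 by lra.
have cxy : cell g y = cell g x by apply: He; lra.
have := exch_cell TP Hy Hx cxy => Exy.
split=> //; rewrite !itineraryS cxy; congr (_ :: _).
by apply: (Hd _ _).2; lra.
Qed.

Definition mark (x : R) := exists i, x = g i.

Lemma cell_lt_mark (y x : R) : y < x -> mark x -> cell g y <> cell g x.
Proof.
move=> yx [i xi] /(cell_eq g (ltW yx))/(_ i) H; apply: H; by rewrite -xi yx lexx.
Qed.

(** Near an unmarked point T is a translation on both sides, and it cannot send
the points on the left below 0. *)
Lemma exch_gt0 (x : R) : 0 < x < 1 -> ~ mark x -> 0 < T x.
Proof.
move=> Hx Nx.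
have [i xi|e e0 He] := @cell_left_point _ _ g x; first by apply: Nx; exists i.
pose y := Num.max (x / 2) (x - e / 2).
have xy : y < x by rewrite gt_max; apply/andP; split; lra.
have [y1 y2] : x / 2 <= y /\ x - e / 2 <= y by rewrite !le_max !lexx orbT.
have Hy : 0 <= y < 1 by lra.
have := exch_cell TP Hy (_ : 0 <= x < 1) (He _ _).
have := exch_itv TP Hy; lra.
Qed.

(** A fixed point 0 being excluded by aperiodicity, 0 is the image of a marked
point: an orbit that goes through 0 counts as coming from a marked point. *)
Lemma exch_eq0 (x : R) : 0 <= x < 1 -> T x = 0 -> mark x.
Proof.
move=> Hx Tx0; apply: contrapT => Nx.
have [x0|x0] := eqVneq x 0.
  by apply: (@exch_aper _ _ _ _ TP x 0%N) => //=; rewrite Tx0.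
have : 0 < T x by apply: exch_gt0 => //; lra.
by rewrite Tx0 ltxx.
Qed.

Lemma itinerary_left m (x : R) : 0 < x < 1 ->
  (forall i, (i < m)%N -> ~ mark (iter i T x)) ->
  exists2 e, 0 < e & forall y, x - e < y <= x -> 0 <= y /\ itinerary y m = itinerary x m.
Proof.
elim: m x => [|m IH] x Hx Nx; first by exists x; [lra|move=> y ?; split=> //; lra].
have [i xi|e e0 He] := @cell_left_point _ _ g x.
  by apply: (Nx 0%N) => //; exists i.
have TH : 0 < T x < 1.
  rewrite exch_gt0 //=; last exact: (Nx 0%N).
  by have := @exch_itv _ _ _ _ TP x; lra.
have [i im|d d0 Hd] := IH _ TH; first by rewrite -iterSr; apply: Nx.
exists (Num.min (Num.min e d) x); first by rewrite !lt_min e0 d0; lra.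
move=> y /andP[+ xy]; rewrite ltrBlDr -ltrBlDl !lt_min => /andP[/andP[ye yd] y1].
have Hy : 0 <= y < 1 by lra.
have cxy : cell g y = cell g x by apply: He; lra.
have := exch_cell TP Hy (_ : 0 <= x < 1) cxy => Exy.
split; first lra. rewrite !itineraryS cxy; congr (_ :: _).
by apply: (Hd _ _).2; lra.
Qed.

(** On the left of z, T is a translation, whose value extended to z is z'. If z
is unmarked this is the value of T; at the marked points and at 1 it is the
value of the exchange with intervals closed on the right. *)
Lemma left_germ (z : R) : 0 < z <= 1 -> exists z' : R, [/\ 0 < z' <= 1,
  exists2 e, 0 < e & forall y, z - e < y < z -> 0 <= y < 1 /\ T y = y + (z' - z) &
  z < 1 -> ~ mark z -> z' = T z].
Proof.
move=> Hz; have [e e0 He] := cell_left g z.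
pose d := Num.min e z.
have [d0 de dz] : [/\ 0 < d, d <= e & d <= z].
  by rewrite lt_min !ge_min !lexx orbT e0; split=> //; lra.
pose y0 := z - d / 2.
have Hy0 : 0 <= y0 < 1 by rewrite /y0; lra.
have E y : z - d < y < z -> 0 <= y < 1 /\ T y - y = T y0 - y0.
  move=> Hy; have Hy1 : 0 <= y < 1 by lra.
  split=> //; apply: (exch_cell TP) => //.
  by apply: He; rewrite /y0; lra.
exists (z + (T y0 - y0)); split.
- pose c := T y0 - y0; rewrite -/c.
  have Hc y : z - d < y < z -> 0 <= y + c < 1.
    by move=> /E[Hy Ey]; have := exch_itv TP Hy; rewrite /c; lra.
  have H1 : z + c <= 1.
    rewrite leNgt; apply/negP => H.
    (* a point close to z on the left whose image would be at least 1 *)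
  pose y := Num.max y0 (1 - c).
    have : 0 <= y + c < 1.
      apply: Hc; rewrite lt_max gt_max /y0; apply/andP.
      by split; [apply/orP; left|apply/andP; split]; lra.
    have : 1 - c <= y by rewrite le_max lexx orbT.
    lra.
  have := Hc y0; rewrite /y0; lra.
- by exists d => // y /E[Hy Ey]; split=> //; lra.
- move=> z1 Nz.
  have [i xi|e' e'0 He'] := @cell_left_point _ _ g z; first by case: Nz; exists i.
  pose y := Num.max y0 (z - e' / 2).
  have yz : y < z by rewrite gt_max /y0; apply/andP; split; lra.
  have [y1 y2] : y0 <= y /\ z - e' / 2 <= y by rewrite !le_max !lexx orbT.
  have Hyd : z - d < y < z by rewrite yz andbT; move: y1; rewrite /y0; lra.
  have [Hy Ey] := E y Hyd.
  have := exch_cell TP Hy (_ : 0 <= z < 1) (He' _ _); lra.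
Qed.

End Exchange.

(** * Bounded entry times *)

Section BoundedEntry.
Variables (R : realType) (k : nat) (T : R -> R) (g : 'I_k -> R).
Hypothesis TP : minimal_exchange T g.

Lemma left_limit_map : exists Tl : R -> R, forall z : R, 0 < z <= 1 ->
  [/\ 0 < Tl z <= 1,
      exists2 e, 0 < e & forall y, z - e < y < z -> 0 <= y < 1 /\ T y = y + (Tl z - z) &
      z < 1 -> ~ mark g z -> Tl z = T z].
Proof.
suff /choice[Tl HTl] : forall z : R, exists z', 0 < z <= 1 -> [/\ 0 < z' <= 1,
    exists2 e, 0 < e & forall y, z - e < y < z -> 0 <= y < 1 /\ T y = y + (z' - z) &
    z < 1 -> ~ mark g z -> z' = T z] by exists Tl.
move=> z; case: (pselect (0 < z <= 1)) => [Hz|]; last by exists 0.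
by have [z' Hz'] := left_germ TP Hz; exists z'.
Qed.

(** An orbit of the left-limit map Tl that met the marked points or 1
infinitely often would meet one of them twice, hence contain a Tl-periodic
point; all the points close to it on the left would then be T-periodic. *)
Lemma left_orbit_regular (Tl : R -> R) (z : R) :
  (forall z : R, 0 < z <= 1 -> 0 < Tl z <= 1 /\
     exists2 e, 0 < e & forall y, z - e < y < z -> 0 <= y < 1 /\ T y = y + (Tl z - z)) ->
  0 < z <= 1 ->
  exists n0, forall n, (n0 <= n)%N -> iter n Tl z < 1 /\ ~ mark g (iter n Tl z).
Proof.
move=> HTl Hz.
have itl n y : 0 < y <= 1 -> 0 < iter n Tl y <= 1.
  by move=> Hy; elim: n => //= n /HTl[].
have germ n y : 0 < y <= 1 -> exists2 e, 0 < e &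
    forall u, y - e < u < y -> 0 <= u < 1 /\ iter n T u = u + (iter n Tl y - y).
  move=> Hy; elim: n => [|n [e e0 He]] /=.
    by have [_ [e e0 He]] := HTl y Hy; exists e => // u /He[Hu _]; split=> //; lra.
  have [_ [d d0 Hd]] := HTl _ (itl n _ Hy).
  exists (Num.min e d) => [|u]; first by rewrite lt_min e0.
  move=> /andP[]; rewrite ltrBlDr -ltrBlDl lt_min => /andP[ue ud] uy.
  have [|Hu Eu] := He u; first lra.
  have [|_] := Hd (iter n T u); first by rewrite Eu; lra.
  by split=> //; lra.
(* a repetition is a Tl-periodic point p, and T^(m - n) is the identity on its left *)
have inj n m : (n < m)%N -> iter n Tl z <> iter m Tl z.
  move=> nm E; set p := iter n Tl z in E.
  have Hp : 0 < p <= 1 by apply: itl.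
  have {}E : iter (m - n).-1.+1 Tl p = p.
    by rewrite prednK ?subn_gt0 // /p -iterD subnK ?(ltnW nm).
  have [e e0 He] := germ (m - n).-1.+1 p Hp.
  have [|Hu Eu] := He (p - e / 2); first lra.
  by apply: (@exch_aper _ _ _ _ TP _ (m - n).-1 Hu); rewrite Eu E; lra.
pose pt (c : option 'I_k) : R := if c is Some i then g i else 1.
have [|_ _ [n0 Hn0]] := @uniform_threshold R (option 'I_k)
    (fun c _ m => forall n, (m <= n)%N -> iter n Tl z <> pt c).
  move=> c; exists 1 => //.
  have [[n Hn]|H] := pselect (exists n, iter n Tl z = pt c).
    exists n.+1 => _ m _ nm m' mm'; rewrite -Hn => /esym; apply: inj.
    exact: leq_trans mm'.
  by exists 0%N => _ m _ _ n _ E; apply: H; exists n.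
exists n0 => n nn; split; last by move=> [i /(Hn0 (Some i) _ nn)].
rewrite lt_neqAle; have /andP[_ ->] := itl n _ Hz; rewrite andbT.
by apply/eqP; apply: (Hn0 None).
Qed.

(** The entry time is locally bounded on the right of each point, by density of
its orbit. A point on the left of which it is not locally bounded is sent by
the left-limit map to another such point; but the orbit under this map is
eventually an orbit of T, which enters ]a, b[, where the entry time is 0. *)
Lemma bounded_entry (a b : R) : 0 <= a -> a < b -> b <= 1 ->
  exists B, forall x : R, 0 <= x < 1 -> exists2 n, (n <= B)%N & a < iter n T x < b.
Proof.
move=> a0 ab b1.
pose P u v := exists B, forall x, u <= x < v -> exists2 n, (n <= B)%N & a < iter n T x < b.
suff : P 0 1 by [].
apply: (@interval_induction R P 0 1) => //.
- move=> x y z _ xy yz _ [B HB] [C HC]; exists (maxn B C) => u Hu.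
  have [uy|uy] := ltP u y.
    by have [|n nB Hn] := HB u; [lra|exists n; rewrite ?leq_max ?nB].
  by have [|n nB Hn] := HC u; [lra|exists n; rewrite ?leq_max ?nB ?orbT].
- move=> x Hx; have [n Hn] := exch_dense TP Hx a0 ab b1.
  have [e e0 He] := itinerary_right TP n Hx.
  exists (Num.min e (b - iter n T x)) => [|y]; first by rewrite lt_min e0; lra.
  rewrite -ltrBlDl lt_min => /and3P[xy ye yb] _; exists n => u Hu; exists n => //.
  have [|u1 Eu] := He u; first lra.
  have := itinerary_shift TP (_ : 0 <= u < 1) Hx Eu (leqnn n); lra.
move=> z Hz; apply: contrapT => Nz.
have [Tl HTl] := left_limit_map.
pose bad v := forall e B, 0 < e -> exists2 y, v - e < y < v /\ 0 <= y < 1 &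
  forall n, (n <= B)%N -> ~ (a < iter n T y < b).
have bad_z : bad z.
  move=> e B e0; apply: contrapT => H; apply: Nz.
  exists (Num.min e z) => [|y]; first by rewrite lt_min e0; lra.
  move=> /andP[]; rewrite ltrBlDr -ltrBlDl lt_min => /andP[ye y0] yz _.
  exists B => x Hx; apply: contrapT => Nx; apply: H; exists x; first by split; lra.
  by move=> n nB Hn; apply: Nx; exists n.
have badS v : 0 < v <= 1 -> bad v -> bad (Tl v).
  move=> Hv bv e B e0; have [Hv' [d d0 Hd] _] := HTl v Hv.
  have [|y [Hy Hy1] Ny] := bv (Num.min e d) B.+1; first by rewrite lt_min e0.
  move: Hy => /andP[]; rewrite ltrBlDr -ltrBlDl lt_min => /andP[ye yd] yv.
  have [|_ Ey] := Hd y; first lra.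
  exists (T y); first by split; [lra|apply: (exch_itv TP)].
  by move=> n nB; rewrite -iterSr; apply: Ny.
have bad_iter n : 0 < iter n Tl z <= 1 /\ bad (iter n Tl z).
  elim: n => [|n [IH1 IH2]] /=; first by split.
  by split; [have [] := HTl _ IH1|apply: badS].
have [|n0 Hn0] := @left_orbit_regular Tl z _ Hz.
  by move=> v /HTl[].
pose p := iter n0 Tl z.
have Hp : 0 < p <= 1 by have [] := bad_iter n0.
have Tp n : iter n T p = iter (n + n0) Tl z.
  elim: n => //= n ->; have [H1 H2] := Hn0 (n + n0)%N (leq_addl _ _).
  by have [_ _ ->] := HTl _ (bad_iter (n + n0)%N).1.
have [|n Hn] := exch_dense TP (_ : 0 <= p < 1) a0 ab b1.
  by have [] := Hn0 n0 (leqnn _); rewrite -/p; lra.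
rewrite Tp in Hn; have [_ bn] := bad_iter (n + n0)%N.
have [|y [Hy _] /(_ 0%N isT)] := bn (iter (n + n0) Tl z - a) 0%N; first lra.
by apply => /=; lra.
Qed.

(** Backward orbits are dense too: go back as many steps as the bound on the
entry times, and forward to the first entry. *)
Lemma backward_entry (a b y : R) : 0 <= a -> a < b -> b <= 1 -> 0 <= y < 1 ->
  exists n (x : R), [/\ 0 <= x < 1, a < x < b & iter n T x = y].
Proof.
move=> a0 ab b1 Hy; have [B HB] := bounded_entry a0 ab b1.
have [u Hu uy] := iter_surj TP B Hy; have [n nB Hn] := HB u Hu.
(* u is the B-th preimage of y, so its n-th image is the (B - n)-th preimage *)
exists (B - n)%N, (iter n T u); split=> //; first exact: (iter_itv TP).
by rewrite -iterD subnK.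
Qed.

End BoundedEntry.

(** * Connections between marked points *)

Section Connections.
Variables (R : realType) (k : nat) (T : R -> R) (g : 'I_k -> R).
Hypothesis TP : minimal_exchange T g.

(** A connection that is not required to be primitive. *)
Definition connection_end j := exists i m, g j = iter m T (T (g i)).

Lemma marks_itv i : 0 <= g i < 1.
Proof. by have := exch_marks TP i; lra. Qed.

(** A connection of minimal length ending at [g j] is primitive. *)
Lemma connection_end_primitive j : connection_end j ->
  exists i m, primitive_connection T g i j m.
Proof.
move=> [i [m]]; elim/ltn_ind: m i => m IH i E.
have [[p [l [pm El]]]|H] := pselect (exists p l, (p < m)%N /\ iter p T (T (g i)) = g l).
  apply: (IH (m - p.+1)%N _ l); first by lia.
  by rewrite -El -iterS -iterD E; congr (iter _ _ _); lia.
exists i, m; split=> // p l pm El; apply: H; by exists p, l.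
Qed.

(** Going backward from [g j], the first marked point is the only possible
start of a primitive connection. *)
Lemma primitive_connection_inj j i i' m m' :
  primitive_connection T g i j m -> primitive_connection T g i' j m' ->
  i = i' /\ m = m'.
Proof.
wlog mm : i i' m m' / (m <= m')%N.
  move=> W; have [mm|/ltnW mm] := leqP m m'; first exact: W.
  by move=> H1 H2; have [] := W _ _ _ _ mm H2 H1.
move=> [E _] [E' N'].
have Ei : g i = iter (m' - m) T (g i').
  apply: (@iter_inj _ _ _ _ TP m.+1); first exact: marks_itv.
    exact/(iter_itv TP)/marks_itv.
  by rewrite -iterD addSn subnKC // !iterSr -E -E'.
have mE : m = m'.
  apply/eqP; rewrite eqn_leq mm /= leqNgt; apply/negP => lt_m.
  apply: (N' (m' - m).-1 i); first by lia.
  by rewrite -iterSr prednK ?subn_gt0.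
by split=> //; apply: (exch_marks_inj TP); rewrite Ei mE subnn.
Qed.

Lemma card_not_connection_end c r :
  (primitive_connections T g #= `I_c)%card -> (r + c)%N = k ->
  #|[set j | ~~ `[< connection_end j >]]%SET| = r.
Proof.
move=> Hc rck.
pose B := [set j | `[< connection_end j >]]%SET.
suff BE : #|B| = c.
  have -> : [set j | ~~ `[< connection_end j >]]%SET = ~: B.
    by apply/setP => j; rewrite !inE.
  by have := cardsC B; rewrite card_ord BE; lia.
apply/(@card_eq_II _ _)/card_esym; apply: card_eq_trans (card_eq_finset B).
apply: card_eq_trans (card_esym Hc) _.
suff -> : [set` B] = (fun c : 'I_k * 'I_k * nat => c.1.2) @` primitive_connections T g.
  apply/card_esym/inj_card_eq => -[[i j] m] [[i' j'] m'].
  rewrite !inE /= /primitive_connections /= => H1 H2 jj; rewrite -jj in H2.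
  by rewrite -jj; have [-> ->] := primitive_connection_inj H1 H2.
apply/seteqP; split=> [j|_ [[[i j] m] [E _] <-]] /=; rewrite inE.
  move=> /asboolP/connection_end_primitive[i [m H]].
  by exists (i, j, m).
by apply/asboolP; exists i, m.
Qed.

End Connections.

(** * Return paths as first returns to a cylinder *)

Section ReturnWords.
Variables (R : realType) (k : nat) (T : R -> R) (g : 'I_k -> R).
Hypothesis TP : minimal_exchange T g.
Local Notation itin := (itinerary T g).
Local Notation L := (coding_language T g).

Lemma itinerary_cat x m p : itin x (m + p) = itin x m ++ itin (iter m T x) p.
Proof.
elim: m x => [|m IH] x; first by rewrite add0n.
by rewrite addSn !itineraryS IH iterSr.
Qed.

Lemma itinerary_window x m l p : (l + p <= m)%N ->
  take p (drop l (itin x m)) = itin (iter l T x) p.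
Proof.
move=> lpm; rewrite -(subnKC lpm) -addnA !itinerary_cat.
by rewrite drop_size_cat ?size_itinerary // take_size_cat ?size_itinerary.
Qed.

(** The factors of the trajectories are prefixes of trajectories, since the
domain is invariant. *)
Lemma coding_languageP u : L u <-> exists2 x : R, 0 <= x < 1 & u = itin x (size u).
Proof.
split=> [[x [m [Hx E]]]|[x Hx E]].
  exists (iter m T x).
    by apply: (iter_itv TP); move: Hx; rewrite /unit_itv /= in_itv.
  rewrite {1}E; apply: eq_mkseq => l.
  by rewrite /trajectory addnC iterD.
by exists x, 0%N; split=> //; rewrite /unit_itv /= in_itv.
Qed.

Lemma last_itinerary x m : last ord0 (itin x m.+1) = cell g (iter m T x).
Proof. by rewrite -[m.+1]addn1 itinerary_cat last_cat. Qed.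

Variables (n : nat) (w : seq 'I_k.+1).

(** The words of the vertices are given length n.+1, to match length M.+1 and
because a vertex has a last letter. *)
Definition cylinder (x : R) := 0 <= x < 1 /\ itin x n.+1 = w.

Definition first_return (x : R) (t : nat) :=
  [/\ (0 < t)%N, cylinder (iter t T x) &
      forall i, (0 < i < t)%N -> ~ cylinder (iter i T x)].

(** The intermediate vertices of the return path of a point that returns at
time t: the windows at the times 1, ..., t - 1. *)
Definition return_vertices (x : R) (t : nat) :=
  mkseq (fun i => itin (iter i.+1 T x) n.+1) t.-1.

Lemma rcons_return_vertices x t : first_return x t ->
  rcons (return_vertices x t) w = mkseq (fun i => itin (iter i.+1 T x) n.+1) t.
Proof.
case: t => [[]//|t [_ [_ Ew] _]].
by rewrite /return_vertices /= /mkseq -[t.+1]addn1 iotaD map_cat /= cats1 -Ew.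
Qed.

(** The label of a return path is the itinerary delayed by the length of w: the
letter added by each vertex is its last one. *)
Lemma return_label_vertices x t : first_return x t ->
  return_label w (return_vertices x t) = itin (iter n.+1 T x) t.
Proof.
move=> Hr; rewrite /return_label rcons_return_vertices // /mkseq -map_comp.
apply: eq_map => i; rewrite [LHS](last_itinerary (iter i.+1 T x) n).
by rewrite /trajectory -!iterD; congr (cell g (iter _ _ _)); lia.
Qed.

Lemma return_word x t : cylinder x -> first_return x t ->
  w ++ return_label w (return_vertices x t) = itin x (t + n.+1).
Proof.
move=> [_ Ew] Hr.
by rewrite return_label_vertices // addnC itinerary_cat Ew.
Qed.

Lemma rauzy_edge_itinerary (x : R) : 0 <= x < 1 ->
  rauzy_edge L n.+1 (itin x n.+1) (itin (T x) n.+1).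
Proof.
move=> Hx.
have V y : 0 <= y < 1 -> rauzy_vertex L n.+1 (itin y n.+1).
  move=> Hy; split; last exact: size_itinerary.
  by apply/coding_languageP; exists y; rewrite ?size_itinerary.
split; [exact: V|exact/V/(exch_itv TP)|].
have E : itin (T x) n.+1 = rcons (itin (T x) n) (cell g (iter n.+1 T x)).
  by rewrite -[in LHS]addn1 itinerary_cat -cats1 -iterSr.
exists (cell g x), (itin (T x) n), (cell g (iter n.+1 T x)).
split; [exact: itineraryS|exact: E|].
by rewrite -E -itineraryS; apply/coding_languageP; exists x; rewrite ?size_itinerary.
Qed.

Lemma return_path_vertices x t : cylinder x -> first_return x t ->
  return_path L n.+1 w (return_vertices x t).
Proof.
move=> Jx Hr; have [Hx Ew] := Jx; have [t0 Jt Nt] := Hr.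
have st : (size (return_vertices x t)).+1 = t by rewrite size_mkseq prednK.
have nthE l : (l <= t)%N ->
    nth w (w :: rcons (return_vertices x t) w) l = itin (iter l T x) n.+1.
  case: l => [//|l lt]; rewrite rcons_return_vertices //= nth_mkseq //.
rewrite /return_path /= return_word //; split.
- apply/(pathP w) => l; rewrite size_rcons st => lt; apply/asboolP.
  have := nthE l.+1 lt; rewrite /= => ->; rewrite nthE; last exact: ltnW.
  by apply: rauzy_edge_itinerary; apply: (iter_itv TP).
- apply/negP => /mapP[i]; rewrite mem_iota add0n => /andP[_ it] E.
  apply: (Nt i.+1); first by lia.
  by split; [apply: (iter_itv TP)|rewrite -E].
- by apply/coding_languageP; exists x; rewrite ?size_itinerary.
- move=> l; rewrite st => lt; rewrite nthE //.
  by apply: itinerary_window; rewrite leq_add2r.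
Qed.

(** The last two conditions on a return path say that its word is the itinerary
of a point, and that its vertices are the windows of this itinerary. *)
Lemma return_path_inv p : size w = n.+1 -> return_path L n.+1 w p ->
  exists x, [/\ cylinder x, first_return x (size p).+1 &
    p = return_vertices x (size p).+1].
Proof.
move=> sw [_ wp /coding_languageP[x Hx]].
set W := w ++ _ => EW HW.
have sW : size W = ((size p).+1 + n.+1)%N.
  by rewrite size_cat size_map size_rcons sw addnC.
have win l : (l <= (size p).+1)%N -> itin (iter l T x) n.+1 = nth w (w :: rcons p w) l.
  by move=> lp; rewrite -HW // EW sW itinerary_window // leq_add2r.
have winp i : (i < size p)%N -> itin (iter i.+1 T x) n.+1 = nth w p i.
  by move=> ip; rewrite win ?ltnS 1?ltnW //= nth_rcons ip.
exists x; split.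
- by split=> //; rewrite -[x]/(iter 0 T x) win.
- split=> //.
    split; first exact: (iter_itv TP).
    by rewrite win //= nth_rcons ltnn eqxx.
  move=> [//|i] /andP[_ ip] [_ E]; move/negP: wp; apply.
  by rewrite -E winp // mem_nth.
apply: (@eq_from_nth _ w); first by rewrite size_mkseq.
by move=> i ip; rewrite nth_mkseq // winp.
Qed.

(** A return path determines its word, hence the itinerary of a point that
follows it until the end of the window at the return time. *)
Lemma return_vertices_inj x y t s : cylinder x -> cylinder y ->
  first_return x t -> first_return y s ->
  return_vertices x t = return_vertices y s ->
  t = s /\ itin x (t + n.+1) = itin y (t + n.+1).
Proof.
move=> Jx Jy Hx Hy E.
have ts : t = s.
  have := congr1 size E; rewrite !size_mkseq.
  by case: Hx Hy => [+ _ _] [+ _ _]; lia.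
by split=> //; rewrite -return_word // E ts return_word // -ts.
Qed.

(** Conversely this part of the itinerary determines the return path, as it
shows whether each intermediate point is in the cylinder. *)
Lemma first_return_itinerary (x y : R) t : 0 <= x < 1 -> 0 <= y < 1 ->
  itin x (t + n.+1) = itin y (t + n.+1) ->
  cylinder x -> first_return x t ->
  [/\ cylinder y, first_return y t & return_vertices y t = return_vertices x t].
Proof.
move=> Hx Hy E Jx [t0 Jt Nt].
have win i : (i <= t)%N -> itin (iter i T x) n.+1 = itin (iter i T y) n.+1.
  move=> it; have it' : (i + n.+1 <= t + n.+1)%N by rewrite leq_add2r.
  by rewrite -(itinerary_window x it') E itinerary_window.
have JJ i : (i <= t)%N -> cylinder (iter i T x) <-> cylinder (iter i T y).
  by move=> it; split=> -[_ Ew]; split; rewrite ?win // -?win //; apply: (iter_itv TP).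
split.
- exact/(JJ 0%N).
- split=> //; first exact/JJ.
  by move=> i it /(JJ i) H; apply: (Nt i) => //; apply: H; lia.
by apply/eq_in_map => i; rewrite mem_iota => /andP[_ it]; rewrite win //; lia.
Qed.

Lemma cylinder_right (x : R) : cylinder x -> exists2 e, 0 < e &
  forall y, x <= y < x + e -> cylinder y.
Proof.
move=> [Hx Ew]; have [e e0 He] := itinerary_right TP n.+1 Hx.
by exists e => // y Hy; have [y1 Ey] := He y Hy; split; [lra|rewrite Ey].
Qed.

Lemma first_return_exists (x : R) : cylinder x -> exists t, first_return x t.
Proof.
move=> Jx; have [Hx _] := Jx; have [e e0 He] := cylinder_right Jx.
have x0 : 0 <= x by lra.
have xe : x < Num.min (x + e) 1 by rewrite lt_min; lra.
have e1 : Num.min (x + e) 1 <= 1 by rewrite ge_min lexx orbT.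
have [m Hm] := exch_dense TP (exch_itv TP Hx) x0 xe e1.
have Em : exists t, (0 < t)%N && `[< cylinder (iter t T x) >].
  exists m.+1; apply/asboolP; rewrite iterSr; apply: He.
  by move: Hm; rewrite lt_min; lra.
have [t /andP[t0 /asboolP Jt] tmin] := ex_minnP Em.
exists t; split=> // i /andP[i0 it] Ji.
by have := tmin i; rewrite i0 (asboolT Ji) leqNgt it => /(_ isT).
Qed.

Lemma cylinder_convex (x y z : R) : cylinder x -> cylinder y -> x <= z <= y -> cylinder z.
Proof.
move=> [Hx Ex] [Hy Ey] /andP[xz zy]; split; first lra.
suff H : forall m, (m <= n.+1)%N -> itin z m = itin x m by rewrite H.
have Exy : itin x n.+1 = itin y n.+1 by rewrite Ey.
have Hz : 0 <= z < 1 by lra.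
elim=> [//|m IH] mn.
rewrite -[m.+1]addn1 !itinerary_cat (IH (ltnW mn)); congr (_ ++ _).
rewrite !itineraryS; congr (_ :: _).
have S1 := itinerary_shift TP Hx Hy Exy (ltnW mn).
have S2 := itinerary_shift TP Hz Hx (IH (ltnW mn)) (leqnn m).
apply/esym/cell_eq => [|i Hi]; first lra.
have /(itinerary_nth T g)/(_ m mn) E := Exy.
have xy' : iter m T x <= iter m T y by lra.
by have /(cell_eq g xy')/(_ i) := E; apply; lra.
Qed.

(** Two points of the cylinder keep their distance during its n.+1 steps and
stay in common cells, so the one on the right never is the left end of a
cell. *)
Lemma cylinder_interior (x y : R) i : cylinder y -> cylinder x -> y < x -> (i <= n)%N ->
  ~ mark g (iter i T x).
Proof.
move=> [Hy Ey] [Hx Ex] yx iN.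
have E : itin y n.+1 = itin x n.+1 by rewrite Ex.
have S := itinerary_shift TP Hy Hx E (leqW iN).
move=> /(@cell_lt_mark _ _ g (iter i T y)); apply; first lra.
by have /(itinerary_nth T g) := E; apply.
Qed.

(** The infimum is attained, because itineraries are locally constant on the
right. *)
Lemma cylinder_min (x0 : R) : cylinder x0 -> exists2 alpha : R, cylinder alpha &
  forall x, cylinder x -> alpha <= x.
Proof.
move=> J0; pose A : set R := [set x | cylinder x].
have hA : has_inf A by split; [exists x0|exists 0 => x [/andP[]]].
have lb x : cylinder x -> inf A <= x by move=> Jx; apply: ge_inf => //; case: hA.
exists (inf A) => //.
have a0 : 0 <= inf A < 1.
  apply/andP; split; first by apply: lb_le_inf => [|x [/andP[]]]; case: hA.
  by apply: le_lt_trans (lb _ J0) _; case: J0 => /andP[].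
have [e e0 He] := itinerary_right TP n.+1 a0.
have [x Jx xe] := inf_adherent e0 hA; split=> //.
have [|_ <-] := He x; first by rewrite (lb _ Jx).
by case: Jx.
Qed.

End ReturnWords.

(** * Counting the return paths *)

Section CutPoints.
Variables (R : realType) (k : nat) (T : R -> R) (g : 'I_k -> R).
Hypothesis TP : minimal_exchange T g.
Variables (M : nat) (w : seq 'I_k.+1).
Hypothesis M_max : forall i j m, primitive_connection T g i j m -> (m <= M)%N.
Local Notation itin := (itinerary T g).
Local Notation J := (cylinder T g M w).
Local Notation first_ret := (first_return T g M w).
Local Notation vertices := (return_vertices T g M).

(** The orbit of x meets the marked points for the first time at [g j], and x
is the first visit to J of the backward orbit of the point that reaches [g j]
after M.+1 steps. *)
Definition cut_point (j : 'I_k) (x : R) := J x /\ exists l,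
  [/\ (M < l)%N, iter l T x = g j,
      forall i, (0 < i <= l - M.+1)%N -> ~ J (iter i T x) &
      forall i, (i < l)%N -> ~ mark g (iter i T x)].

Lemma first_return_uniq x t s : first_ret x t -> first_ret x s -> t = s.
Proof.
move=> [t0 Jt Nt] [s0 Js Ns]; apply/eqP; rewrite eqn_leq.
apply/andP; split; rewrite leqNgt; apply/negP => lt.
  by apply: (Nt s) => //; rewrite s0.
by apply: (Ns t) => //; rewrite t0.
Qed.

Lemma cut_point_uniq j x x' : cut_point j x -> cut_point j x' -> x = x'.
Proof.
(* both first visits are on the same backward orbit: compare their times *)
wlog : x x' / exists l l', [/\ (l <= l')%N, J x /\ J x', iter l T x = iter l' T x',
    (M < l)%N & forall i, (0 < i <= l' - M.+1)%N -> ~ J (iter i T x')].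
  move=> W H H'; have [Jx [l [Ml El Nl _]]] := H.
  have [Jx' [l' [Ml' El' Nl' _]]] := H'.
  have [ll|/ltnW ll] := leqP l l'.
    by apply: W => //; exists l, l'; rewrite El El'.
  by apply/esym; apply: W => //; exists l', l; rewrite El El'.
move=> [l [l' [ll [Jx Jx'] E Ml N]]] _ _.
have {}E : x = iter (l' - l) T x'.
  apply: (@iter_inj _ _ _ _ TP l); [by case: Jx|by apply: (iter_itv TP); case: Jx'|].
  by rewrite -iterD subnKC.
have [l'l|lt] := leqP l' l.
  by rewrite E; move: l'l; rewrite -subn_eq0 => /eqP->.
by case: (N (l' - l)%N); rewrite -?E //; lia.
Qed.

Lemma cut_point_index j j' x : cut_point j x -> cut_point j' x -> j = j'.
Proof.
move=> [_ [l [_ El _ Nl]]] [_ [l' [_ El' _ Nl']]]; apply: (exch_marks_inj TP).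
have [lt|lt|ll] := ltngtP l l'; last by rewrite -El -El' ll.
  by case: (Nl' l lt); exists j.
by case: (Nl l' lt); exists j'.
Qed.

(** The backward orbit of a point that reaches [g j] in M.+1 steps visits J;
take its first visit u. It does not meet the marked points before [g j] since
[g j] ends no connection. If u were alpha then either alpha = 0 would be the
image of a marked point, or the points on the left of alpha would still be in
J. *)
Lemma cut_point_exists j (alpha : R) : J alpha -> (forall x, J x -> alpha <= x) ->
  ~ connection_end T g j -> exists2 x, cut_point j x & alpha < x.
Proof.
move=> Ja amin Nj.
have [z Hz Ez] := iter_surj TP M.+1 (marks_itv TP j).
have Ea : exists m, `[< exists2 u, J u & iter m T u = z >].
  have [e e0 He] := cylinder_right TP Ja; have [Ha _] := Ja.
  have a0 : 0 <= alpha by lra.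
  have ae : alpha < Num.min (alpha + e) 1 by rewrite lt_min; lra.
  have e1 : Num.min (alpha + e) 1 <= 1 by rewrite ge_min lexx orbT.
  have [m [u [Hu + Eu]]] := backward_entry TP a0 ae e1 Hz.
  rewrite lt_min => /and3P[ua ue _]; exists m; apply/asboolP; exists u => //.
  by apply: He; rewrite ltW.
have [m /asboolP[u Ju Eu] mmin] := ex_minnP Ea.
have El : iter (m + M.+1) T u = g j by rewrite addnC iterD Eu.
have Nmark i : (i < m + M.+1)%N -> ~ mark g (iter i T u).
  move=> il [a Ea']; apply: Nj; exists a, (m + M.+1 - i.+1)%N.
  by rewrite -Ea' -iterS -iterD -El; congr (iter _ _ _); lia.
exists u.
  split=> //; exists (m + M.+1)%N; split=> //; first by lia.
  move=> i; rewrite addnK => /andP[i0 im] Ji.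
  have /mmin : `[< exists2 u, J u & iter (m - i) T u = z >].
    by apply/asboolP; exists (iter i T u); rewrite -?iterD ?subnK.
  by lia.
have := amin u Ju; rewrite le_eqVlt => /predU1P[au|//].
have Ha : 0 <= alpha < 1 by case: Ja.
have [a0|a0] := eqVneq alpha 0.
  have [v Hv Ev] := exch_surj TP Ha; rewrite a0 in Ev.
  have [a Ea'] := exch_eq0 TP Hv Ev; case: Nj.
  by exists a, (m + M.+1)%N; rewrite -Ea' Ev -a0 au.
have [|i iM|e e0 He] := @itinerary_left _ _ _ _ TP M.+1 alpha; first by lra.
  by rewrite au; apply: Nmark; lia.
have [|y0 Ey] := He (alpha - e / 2); first by lra.
have /amin : J (alpha - e / 2); last by lra.
by split; [lra|rewrite Ey; case: Ja].
Qed.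

(** The first marked point on the orbit of x is reached after more than M steps
since x is not the least point of J. So it ends no connection: the primitive
one, of length at most M, would provide an earlier marked point. *)
Lemma mark_cut_point (x y : R) t i : J y -> J x -> y < x -> first_ret x t ->
  (i < t + M.+1)%N -> mark g (iter i T x) ->
  exists2 j, ~ connection_end T g j & cut_point j x.
Proof.
move=> Jy Jx yx [t0 Jt Nt] it im.
have Em : exists l, `[< mark g (iter l T x) >] by exists i; apply/asboolP.
have [l /asboolP[j Ej] lmin] := ex_minnP Em.
have li : (l <= i)%N by apply: lmin; apply/asboolP.
have Ml : (M < l)%N.
  rewrite ltnNge; apply/negP => lM.
  by apply: (cylinder_interior TP Jy Jx yx lM); exists j.
have Nl p : (p < l)%N -> ~ mark g (iter p T x).
  by move=> pl /asboolP/lmin; rewrite leqNgt pl.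
exists j.
  move=> /(connection_end_primitive)[a [m Hm]]; have mM := M_max Hm.
  apply: (Nl (l - m.+1)%N); first by lia.
  exists a; apply: (@iter_inj _ _ _ _ TP m.+1).
  - by apply: (iter_itv TP); case: Jx.
  - exact: (marks_itv TP).
  - by rewrite -iterD subnKC ?Ej ?iterSr -?Hm.1 //; lia.
split=> //; exists l; split=> // p /andP[p0 pl] Jp.
by apply: (Nt p) => //; lia.
Qed.

(** The points with the return path of x move along with x until the end of its
return word. On the left of x, they are thus strictly on the left of [g j] when
x reaches it, in another cell. *)
Lemma cut_point_separates j (x y : R) t s : cut_point j x -> J y -> y < x ->
  first_ret x t -> first_ret y s -> vertices x t <> vertices y s.
Proof.
move=> [Jx [l [Ml El Nl _]]] Jy yx Hx Hy E.
have [_ Exy] := return_vertices_inj Jx Jy Hx Hy E.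
have lt : (l < t + M.+1)%N.
  rewrite ltnNge; apply/negP => tl; case: Hx => t0 Jt _.
  by apply: (Nl t) => //; lia.
have S := itinerary_shift TP (proj1 Jx) (proj1 Jy) Exy (ltnW lt).
have /(itinerary_nth T g)/(_ l lt) := Exy.
apply: nesym; apply: cell_lt_mark; first lra.
by exists j.
Qed.

(** The return path is locally constant on the right of each point, and on the
left of each point that is not a cut point. *)
Lemma vertices_constant (ret : R -> nat) (x y : R) :
  (forall u, J u -> first_ret u (ret u)) ->
  J x -> J y -> x < y ->
  (forall u, x < u <= y -> forall j, ~ connection_end T g j -> ~ cut_point j u) ->
  vertices x (ret x) = vertices y (ret y).
Proof.
move=> Hret Jx Jy xy Ncut.
have Jc u : x <= u <= y -> J u by move=> Hu; apply: cylinder_convex Jx Jy Hu.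
have loc u v : J u -> J v -> itin v (ret u + M.+1) = itin u (ret u + M.+1) ->
    vertices u (ret u) = vertices v (ret v).
  move=> Ju Jv E.
  have [_ Hv <-] := first_return_itinerary TP (proj1 Ju) (proj1 Jv) (esym E) Ju (Hret u Ju).
  by rewrite (first_return_uniq Hv (Hret v Jv)).
apply: (@interval_induction R (fun u v => vertices u (ret u) = vertices v (ret v)) x y) => //.
- by move=> u v z _ _ _ _ -> ->.
- move=> u Hu; have Ju : J u by apply: Jc; lra.
  have [e e0 He] := itinerary_right TP (ret u + M.+1) (proj1 Ju).
  exists e => // v Hv vy; apply: loc => //; first by apply: Jc; lra.
  by apply: (He v _).2; lra.
move=> u Hu; have Ju : J u by apply: Jc; lra.
have [||e e0 He] := @itinerary_left _ _ _ _ TP (ret u + M.+1) u.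
- by case: Jx Ju => [+ _] [+ _]; lra.
- move=> i iu im; have xu : x < u by lra.
  have [j Nj Cj] := mark_cut_point Jx Ju xu (Hret u Ju) iu im.
  exact: (Ncut u Hu j).
exists e => // v Hv xv; apply/esym; apply: loc => //; first by apply: Jc; lra.
by apply: (He v _).2; lra.
Qed.

(** Each return path is taken by exactly one point among alpha and the cut
points, namely the left end of the interval of the points that follow it. The
index None stands for alpha. *)
Lemma card_return_paths r (x0 : R) : J x0 ->
  #|[set j | ~~ `[< connection_end T g j >]]%SET| = r ->
  (return_path (coding_language T g) M.+1 w #= `I_r.+1)%card.
Proof.
move=> J0 cardr.
have sw : size w = M.+1 by case: J0 => _ <-; rewrite size_itinerary.
have [alpha Ja amin] := cylinder_min TP J0.
have /choice[ret Hret] : forall x : R, exists t, J x -> first_ret x t.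
  move=> x; have [Jx|NJ] := pselect (J x); last by exists 0%N.
  by have [t Ht] := first_return_exists TP Jx; exists t.
have /choice[cut Hcut] : forall j, exists x : R,
    ~ connection_end T g j -> cut_point j x /\ alpha < x.
  move=> j; have [Cj|Nj] := pselect (connection_end T g j); first by exists 0.
  by have [x] := cut_point_exists Ja amin Nj; exists x.
pose pt (o : option 'I_k) := if o is Some j then cut j else alpha.
pose F o := vertices (pt o) (ret (pt o)).
pose D := (None |: [set Some j | j in [set j | ~~ `[< connection_end T g j >]]])%SET.
have DP o : o \in D -> o = None \/ exists2 j, o = Some j & ~ connection_end T g j.
  rewrite !inE => /predU1P[->|/imsetP[j]]; first by left.
  by rewrite inE => /asboolPn Nj ->; right; exists j.
have DJ o : o \in D -> J (pt o).
  by move=> /DP[->//|[j -> /Hcut[[]]]].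
have cardD : #|D| = r.+1.
  rewrite cardsU1 card_imset; last by move=> ? ? [].
  by rewrite cardr; case: imsetP => // -[].
rewrite -cardD; apply: card_eq_trans (card_eq_finset D).
suff [-> Finj] : return_path (coding_language T g) M.+1 w = F @` [set` D] /\
    {in [set` D] &, injective F} by apply: inj_card_eq.
split; last first.
  have cmp o q : o \in D -> q \in D -> pt o < pt q -> F o <> F q.
    move=> Do Dq lt; apply: nesym.
    have [qN|[j qj Nj]] := DP _ Dq.
      by move: lt; rewrite qN /= ltNge amin //; apply: DJ.
    move: (Hcut _ Nj) => [Cj _]; rewrite /F; apply: (@cut_point_separates j).
    - by rewrite qj.
    - exact: DJ.
    - by [].
    - exact/Hret/DJ.
    - exact/Hret/DJ.
  move=> o q; rewrite !inE /= => Do Dq E.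
  have [lt|lt|Ept] := ltgtP (pt o) (pt q).
  - by case: (cmp _ _ Do Dq lt).
  - by case: (cmp _ _ Dq Do lt).
  have [oN|[j oj Nj]] := DP _ Do; have [qN|[j' qj Nj']] := DP _ Dq.
  - by rewrite oN.
  - by move: (Hcut _ Nj') Ept => [_]; rewrite oN qj /= => + E'; rewrite E' ltxx.
  - by move: (Hcut _ Nj) Ept => [_]; rewrite qN oj /= => + E'; rewrite E' ltxx.
  move: Ept; rewrite oj qj /= => Ept; congr Some.
  by apply: cut_point_index (Hcut _ Nj).1 _; rewrite Ept; apply: (Hcut _ Nj').1.
apply/seteqP; split=> [p Hp|_ [c Dc <-]]; last first.
  by apply: return_path_vertices => //; [apply: DJ|exact/Hret/DJ].
have [x [Jx Hx ->]] := return_path_inv TP sw Hp.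
rewrite (first_return_uniq Hx (Hret x Jx)).
(* the left end of the interval of x is the largest such point below x *)
have : (None \in D) && (pt None <= x) by rewrite !inE amin.
case/(@arg_maxP _ _ _ None (fun o => (o \in D) && (pt o <= x)) pt) => o /andP[Do ox] omax.
exists o => //=; rewrite /F.
have [->//|ptx] := eqVneq (pt o) x.
apply: vertices_constant => //; first exact: DJ.
  by rewrite lt_neqAle ptx.
move=> u /andP[ou ux] j Nj Cj.
have uj : u = cut j by apply: cut_point_uniq Cj (Hcut j Nj).1.
have /omax : (Some j \in D) && (pt (Some j) <= x).
  rewrite /= -uj ux andbT !inE; apply/imsetP; exists j => //.
  by rewrite inE; apply/asboolPn.
by rewrite /= -uj leNgt ou.
Qed.

End CutPoints.

(** * Accumulation of an orbit of the skew product *)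

Section Fibres.
Variables (R : realType) (k : nat) (T : R -> R) (g : 'I_k -> R).
Hypothesis TP : minimal_exchange T g.
Variables (V : finZmodType) (F : R -> V).
Hypothesis F_cell : forall x y : R, 0 <= x < 1 -> 0 <= y < 1 ->
  cell g x = cell g y -> F x = F y.

Definition birkhoff (m : nat) (x : R) : V := \sum_(i < m) F (iter i T x).

Lemma birkhoff0 x : birkhoff 0 x = 0.
Proof. by rewrite /birkhoff big_ord0. Qed.

Lemma birkhoffSr m x : birkhoff m.+1 x = birkhoff m x + F (iter m T x).
Proof. by rewrite /birkhoff big_ord_recr. Qed.

Lemma birkhoffD m p x : birkhoff (m + p) x = birkhoff m x + birkhoff p (iter m T x).
Proof.
elim: p => [|p IH]; first by rewrite addn0 birkhoff0 addr0.
by rewrite addnS !birkhoffSr IH addrA -iterD addnC.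
Qed.

Section Limits.
Variables (x0 : R) (s0 : V).
Hypothesis x0_itv : 0 <= x0 < 1.

(** The fibre values accumulated from the right at x by the orbit of (x0, s0).
Asking for arbitrarily large times m makes the definition compatible with the
preimage under T, even at x0. Accumulation on the right only is what T
respects at its discontinuities. *)
Definition right_limits (x : R) : {set V} :=
  [set h | `[< forall e m0, 0 < e -> exists m, [/\ (m0 <= m)%N,
     x <= iter m T x0 < x + e & s0 + birkhoff m x0 = h] >]]%SET.
Local Notation K := right_limits.

Lemma right_limitsP (h : V) (x : R) :
  reflect (forall e m0, 0 < e -> exists m, [/\ (m0 <= m)%N,
     x <= iter m T x0 < x + e & s0 + birkhoff m x0 = h]) (h \in K x).
Proof. by rewrite inE; apply: asboolP. Qed.

Lemma right_limitsN (h : V) (x : R) : h \notin K x ->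
  exists2 e, 0 < e & exists m0, forall e' m,
  0 < e' <= e -> (m0 <= m)%N -> x <= iter m T x0 < x + e' -> s0 + birkhoff m x0 <> h.
Proof.
move=> /right_limitsP/existsNP[e /existsNP[m0 /not_implyP[e0 H]]].
exists e => //; exists m0 => e' m He' mm Hm E; apply: H; exists m; split=> //.
lra.
Qed.

Lemma right_limits_shift (h : V) (x : R) : 0 <= x < 1 ->
  (h + F x \in K (T x)) = (h \in K x).
Proof.
move=> Hx; have [d d0 Hd] := itinerary_right TP 1 Hx.
have dT u : x <= u < x + d -> [/\ 0 <= u < 1, F u = F x & T u - u = T x - x].
  move=> Hu; have [u1 /(itinerary_nth T g)/(_ 0%N isT) /= E] := Hd u Hu.
  have Hu1 : 0 <= u < 1 by lra.
  by split=> //; [apply: F_cell|apply: (exch_cell TP)].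
apply/right_limitsP/right_limitsP => H e m0 e0.
  have [|m' [mm Hm Em]] := H (Num.min e d) m0.+1; first by rewrite lt_min e0.
  case: m' mm Hm Em => [//|m] mm Hm Em.
  have {}Hm : T x <= T (iter m T x0) /\
      (T (iter m T x0) < T x + e /\ T (iter m T x0) < T x + d).
    move: Hm; rewrite /= -ltrBlDl lt_min => /and3P[]; lra.
  have [|Hu Fu Tu] := dT (x + (T (iter m T x0) - T x)); first lra.
  have Eu : x + (T (iter m T x0) - T x) = iter m T x0.
    by apply: (exch_inj TP) => //; [apply: (iter_itv TP)|lra].
  exists m; split=> //; first lra.
  by apply: (addIr (F x)); rewrite -Em birkhoffSr -addrA -Fu Eu.
have [|m [mm Hm Em]] := H (Num.min e d) m0; first by rewrite lt_min e0.
move: Hm; rewrite -ltrBlDl lt_min => /and3P[xm me md].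
have [|Hu Fu Tu] := dT (iter m T x0); first lra.
exists m.+1; split; first exact: leqW; first by rewrite /=; lra.
by rewrite birkhoffSr addrA Em Fu.
Qed.

Lemma right_limits_image (x : R) : 0 <= x < 1 ->
  K (T x) = [set h + F x | h in K x]%SET.
Proof.
move=> Hx; apply/setP => h; apply/idP/imsetP => [Hh|[h' Hh' ->]].
  by exists (h - F x); rewrite ?subrK // -right_limits_shift // subrK.
by rewrite right_limits_shift.
Qed.

Lemma right_limits_iter (h : V) (x : R) m : 0 <= x < 1 ->
  (h + birkhoff m x \in K (iter m T x)) = (h \in K x).
Proof.
move=> Hx; elim: m => [|m IH]; first by rewrite birkhoff0 addr0.
by rewrite birkhoffSr addrA /= right_limits_shift //; apply: (iter_itv TP).
Qed.

Lemma card_right_limits_iter (x : R) m : 0 <= x < 1 -> #|K (iter m T x)| = #|K x|.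
Proof.
move=> Hx; elim: m => //= m <-.
rewrite right_limits_image; last exact: (iter_itv TP).
by rewrite card_imset //; apply: addIr.
Qed.

(** An accumulation on the right of y is an accumulation on the right of x when
y is on the right of x and close enough, the fibre being finite. *)
Lemma right_limits_semicontinuous (x : R) : exists2 e, 0 < e &
  forall y, x <= y < x + e -> K y \subset K x.
Proof.
have [|e e0 [m0 H]] := @uniform_threshold R V (fun h e m0 => h \notin K x ->
    forall m, (m0 <= m)%N -> x <= iter m T x0 < x + e -> s0 + birkhoff m x0 <> h).
  move=> h; have [hK|/right_limitsN[e e0 [m0 H]]] := boolP (h \in K x).
    by exists 1 => //; exists 0%N.
  exists e => //; exists m0 => e' m1 He' mm _ m m1m Hm.
  by apply: (H e' m) => //; apply: leq_trans m1m.
exists e => // y Hy; apply/fintype.subsetP => h /right_limitsP hy.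
apply/negPn/negP => hx; have [|m [mm Hm Em]] := hy (x + e - y) m0; first lra.
by apply: (H h hx m mm) Em; lra.
Qed.

(** The orbit of x0 enters each interval on the right of x at arbitrarily large
times, and the fibre is finite. *)
Lemma right_limits_exists (x : R) : 0 <= x < 1 -> exists h, h \in K x.
Proof.
move=> Hx; apply: contrapT => K0.
have [|e e0 [m0 H]] := @uniform_threshold R V (fun h e m0 =>
    forall m, (m0 <= m)%N -> x <= iter m T x0 < x + e -> s0 + birkhoff m x0 <> h).
  move=> h; have /right_limitsN[e e0 [m0 H]] : h \notin K x.
    by apply/negP => hK; apply: K0; exists h.
  exists e => //; exists m0 => e' m1 He' mm m m1m Hm.
  by apply: (H e' m) => //; apply: leq_trans m1m.
have H0 : 0 <= x by lra.
have xe : x < Num.min (x + e) 1 by rewrite lt_min; lra.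
have e1 : Num.min (x + e) 1 <= 1 by rewrite ge_min lexx orbT.
have [m] := exch_dense TP (iter_itv TP m0 x0_itv) H0 xe e1.
rewrite -iterD lt_min => Hm.
by apply: (H (s0 + birkhoff (m + m0) x0) (m + m0)%N (leq_addl _ _)) => //; lra.
Qed.

(** At a point a where the set has the least cardinal, semicontinuity leaves no
room for a smaller set on the right of a. *)
Lemma right_limits_flat : exists2 a : R, 0 <= a < 1 & exists2 e, 0 < e &
  forall y, a <= y < a + e -> y < 1 -> K y = K a.
Proof.
have Em : exists m, `[< exists2 x, 0 <= x < 1 & #|K x| = m >].
  by exists #|K x0|; apply/asboolP; exists x0.
have [m /asboolP[a Ha Ea] mmin] := ex_minnP Em.
exists a => //; have [e e0 He] := right_limits_semicontinuous a.
exists e => // y Hy y1; apply/eqP; rewrite eqEcard He //= Ea; apply: mmin.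
by apply/asboolP; exists y => //; lra.
Qed.

(** The cardinal is invariant under T, and every orbit enters the interval of
[right_limits_flat]. *)
Lemma card_right_limits (x y : R) : 0 <= x < 1 -> 0 <= y < 1 -> #|K x| = #|K y|.
Proof.
have [a Ha [e e0 He]] := right_limits_flat.
suff H z : 0 <= z < 1 -> #|K z| = #|K a| by move=> Hx Hy; rewrite !H.
move=> Hz.
have H0 : 0 <= a by lra.
have xe : a < Num.min (a + e) 1 by rewrite lt_min; lra.
have e1 : Num.min (a + e) 1 <= 1 by rewrite ge_min lexx orbT.
have [m] := exch_dense TP Hz H0 xe e1; rewrite lt_min => Hm.
by rewrite -(card_right_limits_iter m Hz) He //; lra.
Qed.

Lemma right_limits_right (x : R) : 0 <= x < 1 -> exists2 e, 0 < e &
  forall y, x <= y < x + e -> y < 1 -> K y = K x.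
Proof.
move=> Hx; have [e e0 He] := right_limits_semicontinuous x.
exists e => // y Hy y1; apply/eqP; rewrite eqEcard He //=.
by rewrite (@card_right_limits x y) //; lra.
Qed.

Definition left_flat (x : R) := exists2 e, 0 < e &
  forall y, x - e < y <= x -> 0 <= y -> K y = K x.

(** T is a translation around an unmarked point, and changes the sets on both
sides by the same translation of the fibre. *)
Lemma left_flat_shift (x : R) : 0 < x < 1 -> ~ mark g x -> left_flat (T x) <-> left_flat x.
Proof.
move=> Hx Nx; have Hx1 : 0 <= x < 1 by lra.
have [[]//|d d0 Hd] := @itinerary_left _ _ _ _ TP 1 x Hx.
have dT u : x - d < u <= x -> [/\ 0 <= u < 1, F u = F x & T u - u = T x - x].
  move=> Hu; have [u1 /(itinerary_nth T g)/(_ 0%N isT) /= E] := Hd u Hu.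
  have Hu1 : 0 <= u < 1 by lra.
  by split=> //; [apply: F_cell|apply: (exch_cell TP)].
have KT u : x - d < u <= x -> K (T u) = K (T x) <-> K u = K x.
  move=> /dT[Hu Fu _]; rewrite !right_limits_image // Fu.
  by split=> [/imset_inj->//|->//]; apply: addIr.
split=> -[e e0 He]; exists (Num.min e d); rewrite ?lt_min ?e0 // => y /andP[].
all: rewrite ltrBlDr -ltrBlDl lt_min => /andP[ye yd] yx y0.
  have Hy : x - d < y <= x by lra.
  have [Hy1 _ Ty] := dT y Hy; apply/KT => //; apply: He; first lra.
  by have /andP[] := exch_itv TP Hy1.
have Hu : x - d < y - (T x - x) <= x by lra.
have [Hu1 _ Tu] := dT _ Hu; have -> : y = T (y - (T x - x)) by lra.
by apply/KT => //; apply: He; lra.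
Qed.

End Limits.
End Fibres.

(** * Rigidity of the accumulation sets on a cylinder *)

Section Rigidity.
Variables (R : realType) (k : nat) (T : R -> R) (g : 'I_k -> R).
Hypothesis TP : minimal_exchange T g.
Variables (V : finZmodType) (F : R -> V).
Hypothesis F_cell : forall x y : R, 0 <= x < 1 -> 0 <= y < 1 ->
  cell g x = cell g y -> F x = F y.
Variables (M : nat) (w : seq 'I_k.+1).
Hypothesis M_max : forall i j m, primitive_connection T g i j m -> (m <= M)%N.
Local Notation J := (cylinder T g M w).
Local Notation K := (right_limits T F).

(** A jump of K on the left of x would propagate along the forward orbit until
its first marked point [g j], and along the backward orbit until its first
marked point [g i]: otherwise it would reach the interval where K is constant.
This gives a primitive connection from [g i] to [g j] through x. Since x
reaches [g j] after more than M steps, its length exceeds M. *)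
Lemma left_flat_interior (x0 : R) s0 (y x : R) : 0 <= x0 < 1 ->
  J y -> J x -> y < x -> left_flat T F x0 s0 x.
Proof.
move=> Hx0 Jy Jx yx.
have Hx : 0 < x < 1 by case: Jy Jx => [+ _] [+ _]; lra.
have Hx1 : 0 <= x < 1 by lra.
have [a Ha [e e0 He]] := right_limits_flat T F s0 Hx0.
have H0 : 0 <= a by lra.
have ae : a < Num.min (a + e) 1 by rewrite lt_min; lra.
have e1 : Num.min (a + e) 1 <= 1 by rewrite ge_min lexx orbT.
have flat u : a < u < Num.min (a + e) 1 -> left_flat T F x0 s0 u.
  rewrite lt_min => Hu; exists (u - a) => [|v Hv v0]; first lra.
  by rewrite (He u) ?(He v) //; lra.
(* propagation of a jump along an orbit segment that avoids the marked points *)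
have step u m : 0 < u < 1 -> (forall i, (i < m)%N -> ~ mark g (iter i T u)) ->
    left_flat T F x0 s0 (iter m T u) <-> left_flat T F x0 s0 u.
  move=> Hu Nu; suff [_] : 0 < iter m T u < 1 /\
    (left_flat T F x0 s0 (iter m T u) <-> left_flat T F x0 s0 u) by [].
  elim: m Nu => [|m IH] Nu /=; first by [].
  have [|Hm IH2] := IH; first by move=> i im; apply/Nu/leqW.
  have Nm := Nu m (leqnn _); split.
    have := exch_itv TP (iter_itv TP m (_ : 0 <= u < 1)).
    have := exch_gt0 TP Hm Nm; lra.
  by apply: iff_trans IH2; apply: (left_flat_shift TP F_cell).
apply: contrapT => Nflat.
have El : exists l, `[< mark g (iter l T x) >].
  apply: contrapT => Nl; have [m Hm] := exch_dense TP Hx1 H0 ae e1.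
  apply: Nflat; apply: (step x m Hx _).1; last exact: flat.
  by move=> i im Hi; apply: Nl; exists i; apply/asboolP.
have [l /asboolP[j Ej] lmin] := ex_minnP El.
have Nl i : (i < l)%N -> ~ mark g (iter i T x).
  by move=> il /asboolP/lmin; rewrite leqNgt il.
have Ml : (M < l)%N.
  rewrite ltnNge; apply/negP => lM.
  by apply: (cylinder_interior TP Jy Jx yx lM); exists j.
have [m [u [Hu Iu Eu]]] := backward_entry TP H0 ae e1 Hx1.
have Ep : exists p, (p < m)%N && `[< mark g (iter p T u) >].
  apply: contrapT => Np; apply: Nflat; rewrite -Eu; apply: (step u m _ _).2.
  - by move: Iu; rewrite lt_min; lra.
  - by move=> i im Hi; apply: Np; exists i; rewrite im; apply/asboolP.
  - exact: flat.
have pm p : (p < m)%N && `[< mark g (iter p T u) >] -> (p <= m)%N.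
  by move=> /andP[/ltnW].
have [p /andP[{}pm /asboolP[i Ei]] pmax] := ex_maxnP Ep pm.
have : primitive_connection T g i j (l + (m - p.+1)).
  split=> [|q b qb].
    rewrite -Ei -iterS -iterD -addnA subnK // -Ej -Eu.
    by rewrite iterD.
  rewrite -Ei -iterS -iterD => Eb.
  have [qm|mq] := ltnP (q + p.+1) m.
    have : (q + p.+1 <= p)%N by apply: pmax; rewrite qm; apply/asboolP; exists b.
    by rewrite addnS ltnNge leq_addl.
  apply: (Nl (q + p.+1 - m)%N); first by clear -qb mq pm; lia.
  by exists b; rewrite -Eb -Eu -iterD subnK.
by move=> /M_max lM; move: Ml; rewrite ltnNge (leq_trans (leq_addr _ _) lM).
Qed.

Lemma right_limits_cylinder (x0 : R) s0 (x y : R) : 0 <= x0 < 1 -> J x -> J y ->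
  K x0 s0 x = K x0 s0 y.
Proof.
move=> Hx0; wlog xy : x y / x < y.
  move=> W Jx Jy; have [xy|xy|->//] := ltgtP x y; first exact: W.
  exact/esym/W.
move=> Jx Jy.
have Jc u : x <= u <= y -> J u by move=> Hu; apply: (cylinder_convex TP Jx Jy Hu).
apply: (@interval_induction R (fun u v => K x0 s0 u = K x0 s0 v) x y) => //.
- by move=> u v z _ _ _ _ -> ->.
- move=> u Hu; have Ju : J u by apply: Jc; lra.
  have [e e0 He] := right_limits_right TP F_cell s0 Hx0 (proj1 Ju).
  exists e => // v Hv vy; apply/esym/He; first lra.
  by have [/andP[]] : J v by apply: Jc; lra.
move=> u Hu; have Ju : J u by apply: Jc; lra.
have [|e e0 He] := @left_flat_interior x0 s0 x u Hx0 Jx Ju; first lra.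
exists e => // v Hv xv; apply: He; first lra.
by case: Jx => [+ _]; lra.
Qed.

(** The assumption on A says that no proper nonempty subset of the fibre is
invariant under the sums of F along all the first returns to J. The set of
[right_limits] at a point of J is such an invariant subset. *)
Lemma fibre_dense c0 : J c0 ->
  (forall A : {set V}, (exists h, h \in A) ->
     (forall x t h, J x -> first_return T g M w x t ->
        (h + birkhoff T F t x \in A) = (h \in A)) -> A = [set: V]%SET) ->
  forall (x0 : R) s0 (y : R) s e, 0 <= x0 < 1 -> 0 <= y < 1 -> 0 < e ->
  exists m, y <= iter m T x0 < y + e /\ s0 + birkhoff T F m x0 = s.
Proof.
move=> Jc gen x0 s0 y s e Hx0 Hy e0.
have KT : K x0 s0 c0 = [set: V]%SET.
  apply: gen => [|x t h Jx [t0 Jt _]]; first by apply: (right_limits_exists TP) => //; case: Jc.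
  rewrite (right_limits_cylinder s0 Hx0 Jc Jt) (right_limits_iter TP F_cell) //; last by case: Jx.
  by rewrite (right_limits_cylinder s0 Hx0 Jx Jt).
have /(_ y c0) := card_right_limits TP F_cell s0 Hx0.
rewrite KT => /(_ Hy (proj1 Jc)) Ecard.
have /right_limitsP/(_ e 0%N e0)[m [_ Hm Em]] : s \in K x0 s0 y.
  suff -> : K x0 s0 y = [set: V]%SET by rewrite inE.
  by apply/eqP; rewrite eqEcard finset.subsetT Ecard leqnn.
by exists m.
Qed.

(** A visit to J is reached by successive first returns. *)
Lemma birkhoff_cylinder (P : V -> Prop) x m : P 0 ->
  (forall h h', P h -> P h' -> P (h + h')) ->
  (forall u t, J u -> first_return T g M w u t -> P (birkhoff T F t u)) ->
  J x -> J (iter m T x) -> P (birkhoff T F m x).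
Proof.
move=> P0 PD Pret; elim/ltn_ind: m x => m IH x Jx Jm.
have [->|m0] := posnP m; first by rewrite birkhoff0.
have [t Ht] := first_return_exists TP Jx; have [t0 Jt Nt] := Ht.
have tm : (t <= m)%N by rewrite leqNgt; apply/negP => mt; apply: (Nt m) => //; rewrite m0.
rewrite -(subnKC tm) birkhoffD; apply: PD; first exact: Pret.
by apply: IH => //; [lia|rewrite -iterD subnK].
Qed.

(** The sum along the itinerary up to the first return equals the sum over the
label of the return path: both words, completed by w on opposite sides, are the
itinerary until the end of the window at the return time. *)
Lemma birkhoff_return (phi : 'I_k.+1 -> V) x t :
  (forall u : R, 0 <= u < 1 -> F u = phi (cell g u)) ->
  J x -> first_return T g M w x t ->
  birkhoff T F t x = \sum_(c <- return_label w (return_vertices T g M x t)) phi c.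
Proof.
move=> Fphi Jx Ht; have [[Hx Ew] [t0 [_ Et] _]] := (Jx, Ht).
have S m : birkhoff T F m x = \sum_(c <- itinerary T g x m) phi c.
  rewrite /itinerary /mkseq big_map -[m in iota _ m]subn0 big_mkord.
  by apply: eq_bigr => i _; apply/Fphi/(iter_itv TP).
(* by return_word, the itinerary followed by w is w followed by the label *)
apply: (addIr (\sum_(c <- w) phi c)).
rewrite S -[in LHS]Et -big_cat -itinerary_cat -(return_word Jx Ht) big_cat /=.
by rewrite addrC.
Qed.

End Rigidity.

(** * Interval exchanges are minimal exchanges *)

Section IntervalExchange.
Variables (R : realType) (r : nat).

Section Partition.
Variable lam : 'I_r -> R.
Hypotheses (lam_gt0 : forall i, 0 < lam i) (lam_sum : \sum_(i < r) lam i = 1).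

(** [iet_left lam i] and [iet_right lam i] are convertible to the partial sums
of index i and i.+1. *)
Definition partial_sum (m : nat) : R := \sum_(j < r | (j < m)%N) lam j.

Lemma partial_sum0 : partial_sum 0 = 0.
Proof. by apply: big_pred0. Qed.

Lemma partial_sum1 : partial_sum r = 1.
Proof. by rewrite -lam_sum; apply: eq_bigl => j; rewrite ltn_ord. Qed.

Lemma iet_rightE i : iet_right lam i = iet_left lam i + lam i.
Proof.
rewrite /iet_right (bigD1 i) //= addrC; congr (_ + _).
by apply: eq_bigl => j; rewrite ltn_neqAle andbC.
Qed.

Lemma partial_sum_lt m p : (m < p <= r)%N -> partial_sum m < partial_sum p.
Proof.
move=> /andP[]; elim: p => // p IH mp pr.
have -> : partial_sum p.+1 = partial_sum p + lam (Ordinal pr) := iet_rightE (Ordinal pr).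
move: mp; rewrite ltnS leq_eqVlt => /predU1P[->|mp]; first by rewrite ltrDl.
by rewrite ltr_wpDr ?(ltW (lam_gt0 _)) // IH // ltnW.
Qed.

Lemma partial_sum_le m p : (m <= p <= r)%N -> partial_sum m <= partial_sum p.
Proof.
move=> /andP[]; rewrite leq_eqVlt => /predU1P[->//|mp] pr.
by apply/ltW/partial_sum_lt; rewrite mp.
Qed.

Lemma iet_find (x : R) : 0 <= x < 1 -> exists i, iet_left lam i <= x < iet_right lam i.
Proof.
move=> Hx; have Em : exists m, x < partial_sum m.
  by exists r; rewrite partial_sum1; lra.
have [[|m] xm mmin] := ex_minnP Em.
  by move: xm; rewrite partial_sum0; lra.
have mr : (m < r)%N.
  by apply: mmin; rewrite partial_sum1; lra.
exists (Ordinal mr); rewrite xm andbT leNgt; apply/negP => /mmin.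
by rewrite ltnn.
Qed.

Lemma iet_find_uniq (x : R) i j : iet_left lam i <= x < iet_right lam i ->
  iet_left lam j <= x < iet_right lam j -> i = j.
Proof.
wlog ij : i j / (i <= j)%N.
  move=> W; have [ij|/ltnW ij] := leqP i j; first exact: W.
  by move=> Hi Hj; apply/esym/W.
move=> Hi Hj; apply: val_inj; apply/eqP; rewrite /= eqn_leq ij leqNgt; apply/negP => lt.
have : iet_right lam i <= iet_left lam j.
  by apply: (@partial_sum_le i.+1 j); rewrite lt ltnW.
lra.
Qed.

Lemma iet_left_ge0 i : 0 <= iet_left lam i.
Proof. by apply: sumr_ge0 => j _; apply/ltW. Qed.

Lemma iet_right_le1 i : iet_right lam i <= 1.
Proof. by rewrite -partial_sum1; apply: (@partial_sum_le i.+1); rewrite ltn_ord leqnn. Qed.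

End Partition.

Variables (lam : 'I_r -> R) (pi : 'S_r).
Hypotheses (lam_gt0 : forall i, 0 < lam i) (lam_sum : \sum_(i < r) lam i = 1).

(** The lengths of the images of the intervals, listed from left to right: the
interval i is sent to the position [(pi^-1)%g i]. *)
Definition image_lengths (i : 'I_r) : R := lam (pi i).

Lemma image_lengths_gt0 i : 0 < image_lengths i.
Proof. exact: lam_gt0. Qed.

Lemma image_lengths_sum : \sum_(i < r) image_lengths i = 1.
Proof. by rewrite -lam_sum [RHS](reindex_inj (@perm_inj _ pi)). Qed.

Lemma iet_eq (x : R) i : iet_left lam i <= x < iet_right lam i ->
  iet lam pi x = x + iet_left image_lengths ((pi^-1)%g i) - iet_left lam i.
Proof.
move=> Hi; rewrite /iet; case: pickP => [j Hj|/(_ i)]; last by rewrite Hi.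
rewrite -(iet_find_uniq lam_gt0 Hi Hj); congr (_ + _ - _).
rewrite /iet_left (reindex_inj (@perm_inj _ pi)); apply: eq_bigl => a.
by rewrite permK.
Qed.

Lemma iet_image (x : R) i : iet_left lam i <= x < iet_right lam i ->
  iet_left image_lengths ((pi^-1)%g i) <= iet lam pi x
    < iet_right image_lengths ((pi^-1)%g i).
Proof.
by move=> Hi; rewrite (iet_eq Hi); move: Hi; rewrite !iet_rightE /image_lengths permKV; lra.
Qed.

(** The images of the intervals form the partition associated with
[image_lengths], whence the bijectivity. Two points of a common cell belong to
a common interval, since every right end of an interval other than 1 is
marked. *)
Lemma iet_minimal_exchange (k : nat) (g : 'I_k -> R) :
  minimal_on (@unit_itv R) (iet lam pi) ->
  aperiodic_on (@unit_itv R) (iet lam pi) ->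
  (forall i j : 'I_k, (i < j)%N -> g i < g j) ->
  range (iet_disc lam) `<=` range g ->
  (forall i, 0 < g i < 1 \/ range (iet_disc lam) (g i)) ->
  minimal_exchange (iet lam pi) g.
Proof.
move=> Tmin Taper g_incr discg g01.
have unitE (x : R) : 0 <= x < 1 -> unit_itv x by rewrite /unit_itv /= in_itv.
have disc_lt (i : 'I_r.-1) : (i.+1 < r)%N by have := ltn_ord i; lia.
split.
- move=> x Hx; have [i Hi] := iet_find lam_sum Hx.
  have := iet_image Hi.
  have := iet_left_ge0 image_lengths_gt0 ((pi^-1)%g i).
  have := iet_right_le1 image_lengths_gt0 image_lengths_sum ((pi^-1)%g i).
  lra.
- move=> x y Hx Hy E.
  have [i Hi] := iet_find lam_sum Hx; have [j Hj] := iet_find lam_sum Hy.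
  have Hij := iet_image Hj; rewrite -E in Hij.
  have /perm_inj ij := iet_find_uniq image_lengths_gt0 (iet_image Hi) Hij.
  by move: E; rewrite (iet_eq Hi) (iet_eq Hj) ij; lra.
- move=> y Hy; have [a Ha] := iet_find image_lengths_sum Hy.
  pose x := y - iet_left image_lengths a + iet_left lam (pi a).
  have Hi : iet_left lam (pi a) <= x < iet_right lam (pi a).
    by move: Ha; rewrite !iet_rightE -[image_lengths a]/(lam (pi a)) /x; lra.
  exists x; last by rewrite (iet_eq Hi) permK /x; lra.
  have := iet_left_ge0 lam_gt0 (pi a); have := iet_right_le1 lam_gt0 lam_sum (pi a).
  lra.
- move=> x y; wlog xy : x y / x <= y.
    move=> W Hx Hy E; have [xy|/ltW xy] := leP x y; first exact: W.
    exact/esym/W.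
  move=> Hx Hy /(cell_eq g xy) E; have [i Hi] := iet_find lam_sum Hx.
  suff Hj : iet_left lam i <= y < iet_right lam i.
    by rewrite (iet_eq Hi) (iet_eq Hj); lra.
  apply/andP; split; first lra.
  rewrite ltNge; apply/negP => iy.
  have ir : (i < r.-1)%N.
    rewrite ltnNge; apply/negP => ri.
    have ir : i.+1 = r by have := ltn_ord i; lia.
    have : iet_right lam i = 1 by rewrite -(partial_sum1 lam_sum) -[in RHS]ir.
    lra.
  have [l _ El] : range g (iet_right lam i).
    by apply: discg; exists (Ordinal ir).
  by apply: (E l); rewrite El; lra.
- move=> x a b Hx a0 ab b1.
  have Hm : unit_itv ((a + b) / 2) by apply: unitE; lra.
  have Hnb : nbhs ((a + b) / 2) [set` `]a, b[].
    by apply: near_in_itvoo; rewrite in_itv /=; lra.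
  have [_ [[n _ <-]]] := Tmin x (unitE x Hx) _ Hm _ Hnb.
  by rewrite /= in_itv /= => Hn; exists n.
- by move=> x n Hx; apply: Taper => //; apply: unitE.
- move=> i; case: (g01 i) => // -[j _ <-]; apply/andP; split.
    rewrite -(partial_sum0 lam); apply: (partial_sum_lt lam_gt0 (m := 0) (p := j.+1)).
    exact: ltnW.
  rewrite -(partial_sum1 lam_sum); apply: (partial_sum_lt lam_gt0 (m := j.+1)).
  by rewrite disc_lt leqnn.
move=> i j E; apply: val_inj => /=.
by case: (ltngtP i j) => // /g_incr; rewrite E ltxx.
Qed.

End IntervalExchange.

(** * Subgroups of the fibre *)

Lemma sum_count_mem (I : finType) (s : seq I) (f : I -> int) :
  \sum_(c <- s) f c = \sum_i (count_mem i s)%:Z * f i.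
Proof.
elim: s => [|c s IH]; first by rewrite big_nil big1 // => i _; rewrite mul0r.
rewrite big_cons IH (bigD1 c) //= [in RHS](bigD1 c) //= eqxx addrA.
rewrite add1n intS mulrDl mul1r; congr (_ + _).
by apply: eq_bigr => i ic; rewrite eq_sym (negbTE ic).
Qed.

Lemma intr_Zp_eq0 (N : nat) (z : int) : (1 < N)%N ->
  ((z%:~R : 'Z_N) == 0) = (N %| `|z|)%N.
Proof.
move=> N1; have E (n : nat) : ((n%:R : 'Z_N) == 0) = (N %| n)%N.
  by rewrite -val_eqE /= val_Zp_nat.
by case: z => n; rewrite ?NegzE ?mulrNz ?oppr_eq0 -?pmulrn E //= abszN.
Qed.

(** The integers that stabilize A form a subgroup; it contains N and the d i,
hence, by Bezout, their gcd. *)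
Lemma stable_setT (N : nat) (A : {set 'Z_N}) (I : finType) (d : I -> int) :
  (1 < N)%N -> gcdn N (\big[gcdn/0%N]_i `|d i|%N) = 1%N ->
  (exists h, h \in A) -> (forall i h, (h + (d i)%:~R \in A) = (h \in A)) ->
  A = [set: 'Z_N]%SET.
Proof.
move=> N1 gcd1 [h hA] dA.
pose Q (z : int) := forall h, (h + z%:~R \in A) = (h \in A).
have QD a b : Q a -> Q b -> Q (a + b).
  by move=> Qa Qb u; rewrite rmorphD /= addrA Qb Qa.
have QN a : Q a -> Q (- a).
  by move=> Qa u; rewrite -[LHS]Qa -addrA rmorphN /= addNr addr0.
have Q0 : Q 0 by move=> u; rewrite addr0.
have QMn a (n : nat) : Q a -> Q (a * n%:Z).
  move=> Qa; elim: n => [|n IH]; first by rewrite mulr0.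
  by rewrite intS mulrDr mulr1; apply: QD.
have QM a b : Q a -> Q (b * a).
  move=> Qa; rewrite mulrC; case: b => n; first exact: QMn.
  by rewrite NegzE mulrN; apply/QN/QMn.
have Qabs a : Q a -> Q `|a|%N.
  by case: a => n // /QN; rewrite NegzE opprK abszN.
have Qgcd (a b : nat) : Q a -> Q b -> Q (gcdn a b).
  move=> Qa Qb; have [u [v Euv]] := Bezoutz a b.
  have -> : (gcdn a b)%:Z = u * a + v * b by rewrite Euv.
  by apply: QD; apply: QM.
have QNat : Q N.
  move=> u; suff -> : (N%:Z)%:~R = 0 :> 'Z_N by rewrite addr0.
  by apply/eqP; rewrite intr_Zp_eq0.
have Q1 : Q 1.
  rewrite -[1]/(Posz 1) -gcd1; apply: (Qgcd) => //.
  by apply: (big_ind (fun n : nat => Q n) Q0 Qgcd) => i _; apply: Qabs; apply: dA.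
apply/setP => u; rewrite inE -hA -(subrK h u) addrC.
by have := QMn 1 (u - h : 'Z_N) Q1 h; rewrite mul1r -pmulrn natr_Zp.
Qed.

(** * The skew product *)

Section SkewProduct.
Variables (R : realType) (N : nat) (T : R -> R) (F : R -> 'Z_N).
Local Notation skew := (skew_product T F).
Local Notation D := (@unit_itv R `*` [set: discrete_topology 'Z_N]).

Lemma iter_skew_product m (x : R) (s : 'Z_N) :
  iter m skew (x, s) = (iter m T x, s + birkhoff T F m x).
Proof.
elim: m => [|m IH]; first by rewrite birkhoff0 addr0.
by rewrite iterS IH birkhoffSr addrA.
Qed.

(** The fibre being discrete, density means that every fibre value is attained
close to every point. *)
Lemma minimal_skew_product :
  (forall (x : R) (s : 'Z_N) (y : R) t e, 0 <= x < 1 -> 0 <= y < 1 -> 0 < e ->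
    exists m, y <= iter m T x < y + e /\ s + birkhoff T F m x = t) ->
  minimal_on D skew.
Proof.
move=> H [x s] [/= Dx _] [y t] [/= Dy _] B [[A C] /= [nA nC] AC].
move: Dx Dy; rewrite /unit_itv /= !in_itv /= => Dx Dy.
have /nbhs_ballP[e /= e0 He] := nA.
have [m [Hm Em]] := H x s y t e Dx Dy e0.
exists (iter m skew (x, s)); split; first by exists m.
apply: AC; rewrite iter_skew_product; split => /=.
  apply: He; rewrite /ball /= ltr_distl; lra.
by rewrite Em; apply: nbhs_singleton.
Qed.

Lemma minimal_skew_product_dense (x : R) s (a b : R) t : minimal_on D skew ->
  0 <= x < 1 -> 0 <= a -> a < b -> b <= 1 ->
  exists m, a < iter m T x < b /\ s + birkhoff T F m x = t.
Proof.
move=> skew_min Hx a0 ab b1.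
have Dx : D (x, s : discrete_topology 'Z_N).
  by split=> //; rewrite /unit_itv /= in_itv.
have Dy : D ((a + b) / 2, t : discrete_topology 'Z_N).
  by split=> //; rewrite /unit_itv /= in_itv /=; lra.
have [|_ [[m _ <-] [Hm Em]]] := skew_min _ Dx _ Dy ([set` `]a, b[] `*` [set t]).
  exists ([set` `]a, b[], [set t]) => //; split => /=; last exact: discrete_set1.
  by apply: near_in_itvoo; rewrite in_itv /=; lra.
exists m; move: Hm Em; rewrite iter_skew_product /= in_itv /=; by [].
Qed.

End SkewProduct.

Theorem theorem10 (R : realType)
    (r : nat) (lam : 'I_r -> R) (pi : 'S_r)
    (lam_gt0 : forall i, 0 < lam i) (lam_sum : \sum_(i < r) lam i = 1)
    (T_minimal : minimal_on (@unit_itv R) (iet lam pi))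
    (T_aperiodic : aperiodic_on (@unit_itv R) (iet lam pi))
    (N : nat) (N_ge2 : (2 <= N)%N)
    (q : nat) (zeta : 'I_q -> R) (a : 'I_q.+1 -> int)
    (zeta_incr : forall i j : 'I_q, (i < j)%N -> zeta i < zeta j)
    (zeta_itv : forall i, 0 < zeta i < 1)
    (qbar : nat) (gamma' : 'I_qbar -> R)
    (gamma'_incr : forall i j : 'I_qbar, (i < j)%N -> gamma' i < gamma' j)
    (gamma'_pts : range gamma' = range (iet_disc lam) `|` range zeta)
    (M : nat) (M_max : max_connection_length (iet lam pi) gamma' M)
    (c : nat) (c_card : (primitive_connections (iet lam pi) gamma' #= `I_c)%card)
    (Rr : nat) (Rr_def : (Rr + c)%N = qbar)
    (ftilde : 'I_qbar.+1 -> int)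
    (ftilde_def : forall x, unit_itv x ->
       ftilde (cell gamma' x) = step_fun zeta a x)
    (w : seq 'I_qbar.+1)
    (w_vertex : rauzy_vertex (coding_language (iet lam pi) gamma') M.+1 w) :
  let returns :=
    return_path (coding_language (iet lam pi) gamma') M.+1 w in
  (returns #= `I_Rr.+1)%card /\
  forall P : 'I_Rr.+1 -> seq (seq 'I_qbar.+1),
    injective P -> range P = returns ->
    let U j := return_label w (P j) in
    let xi i j := count_mem i (U j) in
    let d j : int := \sum_(i < qbar.+1) (xi i j)%:Z * ftilde i in
    minimal_on (@unit_itv R `*` [set: discrete_topology 'Z_N])
      (skew_product (iet lam pi) (fun x => (step_fun zeta a x)%:~R : 'Z_N))
    <-> gcdn N (\big[gcdn/0%N]_(j < Rr.+1) `|d j|%N) = 1%N.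
Proof.
set T := iet lam pi; set L := coding_language T gamma'.
have TP : minimal_exchange T gamma'.
  apply: iet_minimal_exchange => //; first by rewrite gamma'_pts; left.
  move=> i; have : range gamma' (gamma' i) by exists i.
  by rewrite gamma'_pts => -[|[j _ <-]]; [right|left].
have M_ge i j m : primitive_connection T gamma' i j m -> (m <= M)%N.
  by case: M_max => -[H1 H2] Hm; [apply: H2 Hm|case: (H1 i j m)].
have [Lw sw] := w_vertex.
have [x0 Hx0 Ew] := (coding_languageP TP w).1 Lw.
have J0 : cylinder T gamma' M w x0 by split=> //; rewrite [in RHS]Ew sw.
have card_good := card_not_connection_end TP c_card Rr_def.
move=> returns; split; first exact: (card_return_paths TP M_ge J0 card_good).
move=> P P_inj P_range U xi d.
set F := fun x => _ : 'Z_N.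
pose phi i : 'Z_N := (ftilde i)%:~R.
have F_phi (u : R) : 0 <= u < 1 -> F u = phi (cell gamma' u).
  by move=> Hu; rewrite /F /phi ftilde_def // /unit_itv /= in_itv.
have F_cell (x y : R) : 0 <= x < 1 -> 0 <= y < 1 ->
    cell gamma' x = cell gamma' y -> F x = F y.
  by move=> Hx Hy E; rewrite !F_phi // E.
have d_return j x t : cylinder T gamma' M w x -> first_return T gamma' M w x t ->
    P j = return_vertices T gamma' M x t -> birkhoff T F t x = (d j)%:~R.
  move=> Jx Ht Pj; rewrite (birkhoff_return TP F_phi Jx Ht) -Pj.
  by rewrite /d -sum_count_mem rmorph_sum.
split=> [skew_min|gcd1].
  set e := gcdn N _.
  pose H (h : 'Z_N) := exists z : int, h = (e%:Z * z)%:~R.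
  have e_dvd j : (e%:Z %| d j)%Z.
    by rewrite dvdzE; apply: dvdn_trans (dvdn_gcdr _ _) _; apply: (biggcdn_inf j).
  have [e' e'0 He'] := cylinder_right TP J0.
  have H0 : 0 <= x0 by lra.
  have xe : x0 < Num.min (x0 + e') 1 by rewrite lt_min; lra.
  have e1 : Num.min (x0 + e') 1 <= 1 by rewrite ge_min lexx orbT.
  have [m [Hm Em]] := minimal_skew_product_dense 0 1 skew_min Hx0 H0 xe e1.
  have Jm : cylinder T gamma' M w (iter m T x0).
    by apply: He'; move: Hm; rewrite lt_min; lra.
  have [z Ez] : H (birkhoff T F m x0).
    apply: (birkhoff_cylinder TP _ _ _ J0 Jm).
    - by exists 0; rewrite mulr0.
    - by move=> _ _ [z ->] [z' ->]; exists (z + z'); rewrite mulrDr rmorphD.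
    move=> u t Ju Ht.
    have [j _ Pj] : range P (return_vertices T gamma' M u t).
      by rewrite P_range; apply: (return_path_vertices TP Ju Ht).
    have /dvdzP[b Eb] := e_dvd j.
    by exists b; rewrite (d_return j u t Ju Ht Pj) Eb mulrC.
  have : ((1 - e%:Z * z)%:~R : 'Z_N) == 0.
    by rewrite rmorphB /= -Ez; move: Em; rewrite add0r => ->; rewrite subrr.
  rewrite intr_Zp_eq0 // => N_dvd.
  have e_dvd1 : (e%:Z %| 1)%Z.
    rewrite -[X in (_ %| X)%Z](subrK (e%:Z * z)).
    apply: rpredD; last by rewrite dvdz_mulr.
    by apply: dvdn_trans N_dvd; apply: dvdn_gcdl.
  by apply/eqP; rewrite -dvdn1.
apply: minimal_skew_product => x s y t e Hx Hy e0.
apply: (fibre_dense TP F_cell M_ge J0) => // A A0 AJ.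
apply: (stable_setT N_ge2 gcd1 A0) => j h.
have Pj : returns (P j) by rewrite -P_range; exists j.
have [u [Ju Hu Pu]] := return_path_inv TP sw Pj.
by rewrite -(d_return j u _ Ju Hu Pu) AJ.
Qed.
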